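(* The full subcategory of $\mathbf{OBD}_{\mathrm{po}}$ consisting of simple properly ordered Bratteli diagrams $B$ with infinite $X_B$ is (contravariantly) equivalent to the full subcategory of $\mathbf{SDS}$ consisting of scaled minimal dynamical systems on Cantor sets (i.e. those $(X,\varphi,x_0,\mathcal{R})$ in $\mathbf{SDS}$ with $X$ homeomorphic to the Cantor set and $\varphi$ minimal).
   Context: **Bratteli diagrams.** A Bratteli diagram $(V,E)$ consists of a vertex set $V=V_0\sqcup V_1\sqcup\cdots$ with each $V_n$ finite and non-empty and $V_0$ a singleton, and an edge set $E=E_1\sqcup E_2\sqcup\cdots$ with each $E_n$ finite and non-empty, together with maps $r,s:E\to V$ (range, source) such that $r(E_n)\subseteq V_n$, $s(E_n)\subseteq V_{n-1}$, $s^{-1}\{v\}\neq\varnothing$ for all $v\in V$ and $r^{-1}\{v\}\ne\varnothing$ for all $v\in V\setminus V_0$. It is simple if for each $n\ge0$ there is $m>n$ such that every $v\in V_n$ is connected to every $w\in V_m$ by a path. An ordered Bratteli diagram $(V,E,\geq)$ is a Bratteli diagram with a partial order on $E$ such that $e,e'$ are comparable iff $r(e)=r(e')$. It is properly ordered if there is exactly one infinite path $(e_1,e_2,\ldots)$ ($e_i\in E_i$, $r(e_i)=s(e_{i+1})$) consisting of maximal edges, and exactly one consisting of minimal edges. $X_B$ is the set of all infinite paths $(e_1,e_2,\ldots)$. **Edge sets.** An ordered edge set from a finite set $S$ to a finite set $T$ is a finite set $F$ with maps $s:F\to S$, $r:F\to T$ and a linear order on each $r^{-1}\{w\}$, $w\in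 T$. If $G$ is an ordered edge set from $T$ to $U$, then $F\circ G=\{(e,g)\in F\times G: r(e)=s(g)\}$, with source $s(e)$, range $r(g)$, and order: for $r(g)=r(g')$, $(e,g)<(e',g')$ iff $g<g'$, or $g=g'$ and $e<e'$. Write $F\cong F'$ if there is a bijection $F\to F'$ preserving sources, ranges and order. For $k<l$, $E_{k,l}=E_{k+1}\circ\cdots\circ E_l$; $E_{k,k}$ consists of one edge from $v$ to $v$ for each $v\in V_k$. **The category $\mathbf{OBD}$.** Objects: ordered Bratteli diagrams. An ordered premorphism $f:B=(V,E,\ge)\to C=(W,S,\ge)$ is a triple $(F,(f_n)_{n\ge0},\geq)$ where $(f_n)$ is an unbounded sequence of integers with $0=f_0\le f_1\le\cdots$, and $F=F_0\sqcup F_1\sqcup\cdots$ where each $F_n$ is a non-empty finite ordered edge set from $V_n$ to $W_{f_n}$ such that every $v\in V_n$ is the source and every $w\in W_{f_n}$ the range of some edge of $F_n$, $F_0$ is a singleton, and $E_{n+1}\circ F_{n+1}\cong F_n\circ S_{f_n,f_{n+1}}$ for all $n\ge0$. The composition of $f:B\to C$ and $g=(G,(g_n),\ge):C\to D$ is $gf=(H,(h_n),\ge)$ with $h_n=g_{f_n}$, $H_n=F_n\circ G_{f_n}$. Premorphisms $f,g:B\to C$ are equivalent if there are positive integers $n_1<m_1<n_2<m_2<\cdots$ with $f_{n_k}<g_{m_k}<f_{n_{k+1}}$ and, for all $k\ge1$, $E_{n_k,m_k}\circ G_{m_k}\cong F_{n_k}\circ S_{f_{n_k},g_{m_k}}$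 and $E_{m_k,n_{k+1}}\circ F_{n_{k+1}}\cong G_{m_k}\circ S_{g_{m_k},f_{n_{k+1}}}$. Morphisms in $\mathbf{OBD}$ are equivalence classes $[f]$, with $[g][f]=[gf]$. $\mathbf{OBD}_{\mathrm{po}}$ is the full subcategory of properly ordered Bratteli diagrams. **The category $\mathbf{SDS}$.** An essentially minimal totally disconnected dynamical system $(X,\varphi,x_0)$ consists of a metrizable compact totally disconnected space $X$, a homeomorphism $\varphi$ of $X$ such that $(X,\varphi)$ has a unique minimal (non-empty closed invariant) subset, and a point $x_0$ of that subset. A Kakutani–Rokhlin partition for it is a finite partition $P=\{Z(k,j): 1\le k\le K,\ 1\le j\le J(k)\}$ of $X$ into non-empty clopen sets with $\varphi(Z(k,j))=Z(k,j+1)$ for $1\le j<J(k)$, and such that the top $Z=\bigcup_kZ(k,J(k))$ contains $x_0$ and $\varphi(Z)=\bigcup_kZ(k,1)$. A system of Kakutani–Rokhlin partitions is a sequence $\mathcal{R}=(P_n)_{n\ge0}$ of such partitions with $P_0=\{X\}$, $P_{n+1}$ refining $P_n$, the tops $Z_n$ of $P_n$ ($n\ge1$) decreasing with intersection $\{x_0\}$, and $\bigcup_nP_n$ a basis for the topology of $X$. Objects of $\mathbf{SDS}$ are quadruples $(X,\varphi,x_0,\mathcal{R})$; morphisms $(X,\varphi,x_0,\mathcal{R})\to(Y,\psi,y_0,\mathcal{S})$ are continuous maps $\alpha:X\to Y$ with $\alpha\circ\varphi=\psi\circ\alpha$ and $\alpha(x_0)=y_0$ (no condition relating $\mathcal{R}$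 and $\mathcal{S}$). Two categories are contravariantly equivalent if there is a full, faithful and essentially surjective contravariant functor from one to the other. *)

(* Defs.v *)
From mathcomp Require Import all_boot all_order all_algebra.
From mathcomp Require Import all_classical all_reals topology cantor.
From Stdlib Require Setoid Morphisms.

Set Implicit Arguments.
Unset Strict Implicit.
Unset Printing Implicit Defensive.

Local Open Scope classical_set_scope.
Local Open Scope nat_scope.

Record category := Category {
  obj :> Type;
  hom : obj -> obj -> Type;
  idm : forall X, hom X X;
  (* diagrammatic order: [compm f g] is "g after f" *)
  compm : forall X Y Z, hom X Y -> hom Y Z -> hom X Z;
  comp1m : forall X Y (f : hom X Y), compm (idm X) f = f;
  compm1 : forall X Y (f : hom X Y), compm f (idm Y) = f;
  compmA : forall X Y Z T (f : hom X Y) (g : hom Y Z) (h : hom Z T),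
    compm f (compm g h) = compm (compm f g) h }.

Arguments hom {c}.
Arguments idm {c}.
Arguments compm {c X Y Z}.

Definition isomorphic (C : category) (X Y : C) : Prop :=
  exists (f : hom X Y) (g : hom Y X),
    compm f g = idm X /\ compm g f = idm Y.

Definition full_subcategory (C : category) (P : C -> Prop) : category :=
  @Category {X : C | P X}
    (fun X Y => hom (sval X) (sval Y))
    (fun X => idm (sval X))
    (fun X Y Z f g => compm f g)
    (fun X Y f => comp1m f)
    (fun X Y f => compm1 f)
    (fun X Y Z T f g h => compmA f g h).

Record contravariant_functor (C D : category) := ContravariantFunctor {
  fobj :> C -> D;
  fmap : forall X Y : C, hom X Y -> hom (fobj Y) (fobj X);
  fmap_id : forall X, fmap (idm X) = idm (fobj X);
  fmap_comp : forall X Y Z (f : hom X Y) (g : hom Y Z),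
    fmap (compm f g) = compm (fmap g) (fmap f) }.

Arguments fmap {C D} _ {X Y}.

Definition full (C D : category) (F : contravariant_functor C D) : Prop :=
  forall (X Y : C) (u : hom (F Y) (F X)), exists f : hom X Y, fmap F f = u.

Definition faithful (C D : category) (F : contravariant_functor C D) : Prop :=
  forall (X Y : C) (f g : hom X Y), fmap F f = fmap F g -> f = g.

Definition essentially_surjective (C D : category)
    (F : contravariant_functor C D) : Prop :=
  forall Y : D, exists X : C, isomorphic (F X) Y.

Definition contravariantly_equivalent (C D : category) : Prop :=
  exists F : contravariant_functor C D,
    [/\ full F, faithful F & essentially_surjective F].

Record edge_set (S T : finType) := EdgeSet {
  edge :> finType;
  src : edge -> S;
  rng : edge -> T;
  ele : rel edge;
  ele_refl : reflexive ele;
  ele_anti : antisymmetric ele;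
  ele_trans : transitive ele;
  ele_comparable : forall e e', (ele e e' || ele e' e) = (rng e == rng e') }.

Arguments src {S T} _ _.
Arguments rng {S T} _ _.
Arguments ele {S T} _ _ _.

Definition src_surj (S T : finType) (F : edge_set S T) : Prop :=
  forall v : S, exists e : F, src F e = v.

Definition rng_surj (S T : finType) (F : edge_set S T) : Prop :=
  forall w : T, exists e : F, rng F e = w.

Definition max_edge (S T : finType) (F : edge_set S T) (e : F) : Prop :=
  forall e' : F, ele F e e' -> e' = e.

Definition min_edge (S T : finType) (F : edge_set S T) (e : F) : Prop :=
  forall e' : F, ele F e' e -> e' = e.

Definition eiso (S T : finType) (F F' : edge_set S T) : Prop :=
  exists h : F -> F',
    [/\ bijective h,
        forall e, src F' (h e) = src F e,
        forall e, rng F' (h e) = rng F e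
      & forall e e', ele F' (h e) (h e') = ele F e e'].

Infix "≅" := eiso (at level 70, no associativity).

Section Composite.
Variables (S T U : finType) (F : edge_set S T) (G : edge_set T U).

Definition ecomp_edge := {p : F * G | rng F p.1 == src G p.2}.

Definition ecomp_le (p q : ecomp_edge) : bool :=
  let: (e, g) := val p in let: (e', g') := val q in
  ((g != g') && ele G g g') || ((g == g') && ele F e e').

Lemma ecomp_le_refl : reflexive ecomp_le.
Proof.
by move=> [[e g] h]; rewrite /ecomp_le /= eqxx (ele_refl e) orbT.
Qed.

Lemma ecomp_le_anti : antisymmetric ecomp_le.
Proof.
move=> [[e g] h] [[e' g'] h']; rewrite /ecomp_le /= (eq_sym g').
case: (eqVneq g g') => [gg'|ne] /=.
  by move=> H; apply: val_inj => /=; rewrite gg' (ele_anti H).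
by rewrite !orbF => H; rewrite (ele_anti H) eqxx in ne.
Qed.

Lemma ecomp_le_trans : transitive ecomp_le.
Proof.
move=> [[e g] h] [[e1 g1] h1] [[e2 g2] h2]; rewrite /ecomp_le /=.
move=> /orP[/andP[n1 l1]|/andP[/eqP -> l1]] /orP[/andP[n2 l2]|/andP[/eqP E2 l2]].
- rewrite (ele_trans l1 l2) andbT; case: (eqVneq g1 g2) => //= E.
  by move: n2; rewrite -E (@ele_anti _ _ G g g1) ?eqxx // l1 andbT E l2.
- by rewrite -E2 n1 l1.
- by rewrite n2 l2.
- by rewrite E2 eqxx (ele_trans l1 l2) orbT.
Qed.

Lemma ecomp_le_comparable (p q : ecomp_edge) :
  (ecomp_le p q || ecomp_le q p) = (rng G (val p).2 == rng G (val q).2).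
Proof.
case: p q => [[e g] h] [[e' g'] h']; rewrite /ecomp_le /= (eq_sym g').
case: (eqVneq g g') => [gg'|ne] /=; last by rewrite !orbF ele_comparable.
subst g'; rewrite eqxx ele_comparable.
by move: h h' => /= /eqP -> /eqP ->; rewrite eqxx.
Qed.

(* Diagrammatic order: in [F ∘ G] the edge of F comes first. Edges with the same
   range are ordered reverse-lexicographically. *)
Definition ecomp : edge_set S U :=
  @EdgeSet S U ecomp_edge
    (fun p => src F (val p).1) (fun p => rng G (val p).2) ecomp_le
    ecomp_le_refl ecomp_le_anti ecomp_le_trans ecomp_le_comparable.

End Composite.

Infix "∘" := ecomp (at level 50, left associativity).

(* One edge from v to w whenever v and w are the same vertex of the family V.
   For k = l this has exactly one edge from v to v for each v; for k <> l it is
   empty. Allowing k <> l avoids transports along equalities of levels. *)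
Section Diagonal.
Variables (V : nat -> finType) (k l : nat).

Definition ediag_edge := {p : V k * V l | Tagged V p.1 == Tagged V p.2}.

Lemma ediag_refl : reflexive (fun p q : ediag_edge => p == q).
Proof. exact: eqxx. Qed.

Lemma ediag_anti : antisymmetric (fun p q : ediag_edge => p == q).
Proof. by move=> p q /andP[/eqP]. Qed.

Lemma ediag_trans : transitive (fun p q : ediag_edge => p == q).
Proof. by move=> p q r /eqP -> /eqP ->. Qed.

Lemma ediag_comparable (p q : ediag_edge) :
  ((p == q) || (q == p)) = ((val p).2 == (val q).2).
Proof.
rewrite (eq_sym q) orbb; apply/eqP/eqP => [-> //|].
case: p q => [[v w] /= h] [[v' w'] /= h'] ww'; apply: val_inj => /=.
subst w'; move: h h' => /eqP <- /eqP; move/eqP; rewrite eq_Tagged /= => /eqP ->.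
by [].
Qed.

Definition ediag : edge_set (V k) (V l) :=
  @EdgeSet (V k) (V l) ediag_edge
    (fun p => (val p).1) (fun p => (val p).2) (fun p q => p == q)
    ediag_refl ediag_anti ediag_trans ediag_comparable.

End Diagonal.

(* [E n] is the edge set from level n to level n.+1, i.e. E_{n+1} in the
   1-based indexing. The order is part of [edge_set]: two edges are comparable
   iff they have the same range. *)
Record obd := OBDiagram {
  V : nat -> finType;
  E : forall n, edge_set (V n) (V n.+1);
  V_nonempty : forall n, 0 < #|V n|;
  V0_singleton : #|V 0| = 1;
  E_nonempty : forall n, 0 < #|E n|;
  E_src_surj : forall n, src_surj (E n);
  E_rng_surj : forall n, rng_surj (E n) }.

Arguments E : clear implicits.

(* The edge set E_{k,l}; it is built starting from E_{k,k}, so E_{k,k+1} is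
   E_{k,k} ∘ E_{k+1}. It is empty if l < k. *)
Fixpoint path_edges (B : obd) (k l : nat) : edge_set (V B k) (V B l) :=
  match l return edge_set (V B k) (V B l) with
  | 0 => ediag (V B) k 0
  | l'.+1 => if k <= l' then path_edges B k l' ∘ E B l' else ediag (V B) k l'.+1
  end.

Definition simple_obd (B : obd) : Prop :=
  forall n, exists2 m, n < m &
    forall (v : V B n) (w : V B m), exists e : path_edges B n m,
      src (path_edges B n m) e = v /\ rng (path_edges B n m) e = w.

Definition path_space (B : obd) : set (forall n, E B n) :=
  [set x | forall n, rng (E B n) (x n) = src (E B n.+1) (x n.+1)].

Arguments path_space B : clear implicits.

Definition properly_ordered (B : obd) : Prop :=
  (exists! x, path_space B x /\ forall n, max_edge (x n)) /\
  (exists! x, path_space B x /\ forall n, min_edge (x n)).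

Record premorphism (B C : obd) := Premorphism {
  lev : nat -> nat;
  pedge : forall n, edge_set (V B n) (V C (lev n));
  lev0 : lev 0 = 0;
  lev_mono : forall n, lev n <= lev n.+1;
  lev_unbounded : forall N, exists n, N <= lev n;
  pedge_nonempty : forall n, 0 < #|pedge n|;
  pedge_src_surj : forall n, src_surj (pedge n);
  pedge_rng_surj : forall n, rng_surj (pedge n);
  pedge0_singleton : #|pedge 0| = 1;
  pedge_comm : forall n,
    E B n ∘ pedge n.+1 ≅ pedge n ∘ path_edges C (lev n) (lev n.+1) }.

Arguments lev {B C}.
Arguments pedge {B C}.

(* The sequences n_1 < m_1 < n_2 < ... are indexed from 0 here. *)
Definition pm_equiv (B C : obd) (f g : premorphism B C) : Prop :=
  exists n m : nat -> nat,
    [/\ 0 < n 0,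
        forall k, n k < m k < n k.+1,
        forall k, lev f (n k) < lev g (m k) < lev f (n k.+1),
        forall k, path_edges B (n k) (m k) ∘ pedge g (m k) ≅
                  pedge f (n k) ∘ path_edges C (lev f (n k)) (lev g (m k))
      & forall k, path_edges B (m k) (n k.+1) ∘ pedge f (n k.+1) ≅
                  pedge g (m k) ∘ path_edges C (lev g (m k)) (lev f (n k.+1))].

Lemma eiso_refl (S T : finType) (F : edge_set S T) : F ≅ F.
Proof. by exists id; split => //; exists id. Qed.

#[local] Hint Resolve eiso_refl : core.

Lemma eiso_sym (S T : finType) (F G : edge_set S T) : F ≅ G -> G ≅ F.
Proof.
move=> [h [[k hK kK] hs hr hl]]; exists k; split; first by exists h.
- by move=> e; rewrite -{2}(kK e) hs.
- by move=> e; rewrite -{2}(kK e) hr.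
- by move=> e e'; rewrite -hl !kK.
Qed.

Lemma eiso_trans (S T : finType) (F G H : edge_set S T) :
  F ≅ G -> G ≅ H -> F ≅ H.
Proof.
move=> [h [hb hs hr hl]] [k [kb ks kr kl]]; exists (k \o h); split.
- exact: bij_comp.
- by move=> e; rewrite /= ks hs.
- by move=> e; rewrite /= kr hr.
- by move=> e e'; rewrite /= kl hl.
Qed.

#[global] Instance eiso_equivalence (S T : finType) :
  RelationClasses.Equivalence (@eiso S T).
Proof.
split; [exact: eiso_refl | exact: eiso_sym | exact: eiso_trans].
Qed.

Lemma ecomp_iso (S T U : finType) (F F' : edge_set S T) (G G' : edge_set T U) :
  F ≅ F' -> G ≅ G' -> F ∘ G ≅ F' ∘ G'.
Proof.
move=> [h [[h' hK h'K] hs hr hl]] [k [[k' kK k'K] ks kr kl]].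
have P (p : F ∘ G) : rng F' (h (val p).1) == src G' (k (val p).2).
  by rewrite hr ks (valP p).
have Q (p : F' ∘ G') : rng F (h' (val p).1) == src G (k' (val p).2).
  by rewrite -hr -ks h'K k'K (valP p).
exists (fun p => exist _ (h (val p).1, k (val p).2) (P p)); split.
- exists (fun p => exist _ (h' (val p).1, k' (val p).2) (Q p)).
  + by move=> [[e g] H]; apply: val_inj; rewrite /= hK kK.
  + by move=> [[e g] H]; apply: val_inj; rewrite /= h'K k'K.
- by move=> [[e g] H]; exact: hs.
- by move=> [[e g] H]; exact: kr.
- move=> [[e g] H] [[e' g'] H']; rewrite /= /ecomp_le /= hl kl.
  by rewrite (can_eq kK).
Qed.

#[global] Instance ecomp_proper (S T U : finType) :
  Morphisms.Proper (Morphisms.respectful (@eiso S T)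
    (Morphisms.respectful (@eiso T U) (@eiso S U))) (@ecomp S T U).
Proof. by move=> F F' FF' G G'; exact: ecomp_iso. Qed.

Lemma ecompA (S T U W : finType) (F : edge_set S T) (G : edge_set T U)
  (H : edge_set U W) : F ∘ (G ∘ H) ≅ F ∘ G ∘ H.
Proof.
pose l (p : F ∘ (G ∘ H)) : F ∘ G :=
  exist _ ((val p).1, (val (val p).2).1) (valP p).
pose r (p : F ∘ G ∘ H) : G ∘ H :=
  exist _ ((val (val p).1).2, (val p).2) (valP p).
exists (fun p => exist _ (l p, (val (val p).2).2) (valP (val p).2)); split.
- exists (fun p => exist _ ((val (val p).1).1, r p) (valP (val p).1)).
  + move=> [[e [[g h] gh]] egh]; apply: val_inj => /=; congr pair.
    exact: val_inj.
  + move=> [[[[e g] eg] h] egh]; apply: val_inj => /=; congr pair.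
    exact: val_inj.
- by [].
- by [].
- move=> [[e [[g h] gh]] egh] [[e' [[g' h'] gh']] egh'].
  rewrite /= /ecomp_le /= /ecomp_le /= -!val_eqE /= !xpair_eqE.
  case: (eqVneq h h') => /= hh; last by rewrite !andbF !orbF.
  by case: (eqVneq g g').
Qed.

Section DiagonalUnit.
Variable V : nat -> finType.

Definition ediag_id k (v : V k) : ediag V k k :=
  exist _ (v, v) (eqxx (Tagged V v)).

Lemma ediag_ind k (P : ediag V k k -> Prop) :
  (forall v, P (ediag_id v)) -> forall p, P p.
Proof.
move=> Pd [[v w] h]; have vw : v = w.
  by apply/eqP; move: h; rewrite eq_Tagged.
by subst w; rewrite (_ : exist _ _ _ = ediag_id v) //; exact: val_inj.
Qed.

Lemma ecomp1e k (T : finType) (F : edge_set (V k) T) : ediag V k k ∘ F ≅ F.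
Proof.
exists (fun p => (val p).2); split.
- exists (fun e => exist _ (ediag_id (src F e), e) (eqxx _)) => //.
  move=> [[p e] /= pe]; apply: val_inj => /=; congr pair.
  by move: pe; elim/ediag_ind: p => v /= /eqP ->.
- by move=> [[p e] /=]; elim/ediag_ind: p => v /= /eqP.
- by [].
- move=> [[p e] /= pe] [[q e'] /= qe]; rewrite /ecomp_le /=.
  case: (eqVneq e e') => [ee|] /=; last by rewrite orbF.
  subst e'; rewrite ele_refl; move: pe qe.
  by elim/ediag_ind: p => v; elim/ediag_ind: q => w /= /eqP -> /eqP ->; rewrite eqxx.
Qed.

Lemma ecompe1 k (T : finType) (F : edge_set T (V k)) : F ∘ ediag V k k ≅ F.
Proof.
exists (fun p => (val p).1); split.
- exists (fun e => exist _ (e, ediag_id (rng F e)) (eqxx _)) => //.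
  move=> [[e p] /= pe]; apply: val_inj => /=; congr pair.
  by move: pe; elim/ediag_ind: p => v /= /eqP ->.
- by [].
- by move=> [[e p] /=]; elim/ediag_ind: p => v /= /eqP.
- move=> [[e p] /= pe] [[e' q] /= qe]; rewrite /ecomp_le /= andNb /=.
  case: (eqVneq p q) => //= npq; apply/negP => l.
  have /eqP : rng F e == rng F e' by rewrite -ele_comparable l.
  move/eqP: npq; move: pe qe.
  by elim/ediag_ind: p => v; elim/ediag_ind: q => w /= /eqP -> /eqP -> n /(congr1 (@ediag_id k)).
Qed.

End DiagonalUnit.

Section PathEdges.
Variable B : obd.

Lemma path_edges_diag k : path_edges B k k = ediag (V B) k k.
Proof. by case: k => //= k; rewrite ltnn. Qed.

Lemma path_edges_recr k l : k <= l ->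
  path_edges B k l.+1 = path_edges B k l ∘ E B l.
Proof. by move=> /= ->. Qed.

Lemma path_edges_cat k l m : k <= l -> l <= m ->
  path_edges B k l ∘ path_edges B l m ≅ path_edges B k m.
Proof.
move=> kl; elim: m => [|m IH] lm.
  by move: lm; rewrite leqn0 => /eqP ->; exact: ecompe1.
move: lm; rewrite leq_eqVlt => /predU1P[->|lm].
  by rewrite path_edges_diag; exact: ecompe1.
rewrite (@path_edges_recr l m lm) (@path_edges_recr k m (leq_trans kl lm)).
by rewrite ecompA IH.
Qed.

Lemma path_edges_src_surj k l : k <= l -> src_surj (path_edges B k l).
Proof.
elim: l => [|l IH] kl v.
  move: kl v; rewrite leqn0 => /eqP -> v.
  by exists (exist _ (v, v) (eqxx (Tagged (V B) v))).
move: kl; rewrite leq_eqVlt => /predU1P[E|kl].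
  move: v; rewrite E path_edges_diag => v.
  by exists (exist _ (v, v) (eqxx (Tagged (V B) v))).
rewrite (@path_edges_recr k l kl); have [e <-] := IH kl v.
have [e' h] := @E_src_surj B l (rng _ e).
by exists (exist _ (e, e') (introT eqP (esym h))).
Qed.

End PathEdges.

Section Premorphisms.

Lemma lev_le (B C : obd) (f : premorphism B C) n m :
  n <= m -> lev f n <= lev f m.
Proof.
elim: m => [|m IH]; first by rewrite leqn0 => /eqP ->.
rewrite leq_eqVlt => /predU1P[->//|nm].
exact: leq_trans (IH nm) (lev_mono f m).
Qed.

Lemma lev_ge_large (B C : obd) (f : premorphism B C) N M :
  exists2 n, M <= n & N <= lev f n.
Proof.
have [n Nn] := lev_unbounded f N; exists (maxn M n); first exact: leq_maxl.
by apply: leq_trans Nn (lev_le f _); exact: leq_maxr.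
Qed.

Lemma pedge_comm_le (B C : obd) (f : premorphism B C) n m : n <= m ->
  path_edges B n m ∘ pedge f m ≅
  pedge f n ∘ path_edges C (lev f n) (lev f m).
Proof.
elim: m => [|m IH] nm.
  move: nm; rewrite leqn0 => /eqP ->; rewrite !path_edges_diag.
  by rewrite ecomp1e ecompe1.
move: nm; rewrite leq_eqVlt => /predU1P[->|nm].
  by rewrite !path_edges_diag ecomp1e ecompe1.
rewrite (@path_edges_recr _ n m nm) -ecompA pedge_comm ecompA IH // -ecompA.
by rewrite path_edges_cat ?lev_mono ?lev_le.
Qed.

(* Level-wise criterion for [pm_equiv]; it only serves to prove that [pm_equiv]
   is an equivalence relation compatible with composition. *)
Definition pm_agree (B C : obd) (f g : premorphism B C) : Prop :=
  forall n, exists k, [/\ lev f n <= k, lev g n <= k &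
    pedge f n ∘ path_edges C (lev f n) k ≅ pedge g n ∘ path_edges C (lev g n) k].

Lemma pm_agree_step (B C : obd) (f g : premorphism B C) n N :
  pm_agree f g -> exists m, [/\ n < m, N < lev g m &
    path_edges B n m ∘ pedge g m ≅ pedge f n ∘ path_edges C (lev f n) (lev g m)].
Proof.
move=> /(_ n)[k [fk gk H]]; have [m nm] := lev_ge_large g (maxn k N.+1) n.+1.
rewrite geq_max => /andP[km Nm]; exists m; split => //.
rewrite pedge_comm_le ?(ltnW nm) // -(path_edges_cat C gk km) ecompA -H -ecompA.
by rewrite path_edges_cat.
Qed.

Lemma pm_agree_sym (B C : obd) (f g : premorphism B C) :
  pm_agree f g -> pm_agree g f.
Proof. by move=> H n; have [k [? ? I]] := H n; exists k; split=> //; symmetry. Qed.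

Lemma pm_equivP (B C : obd) (f g : premorphism B C) :
  pm_equiv f g <-> pm_agree f g.
Proof.
split=> [[n [m [n0 nm fg H _]]] j|H].
  have nj k : k <= n k.
    elim: k => // k IH; have /andP[a b] := nm k.
    exact: leq_ltn_trans IH (ltn_trans a b).
  have jn := nj j; have /andP[nmj _] := nm j; have /andP[fgj _] := fg j.
  have jm := leq_trans jn (ltnW nmj).
  exists (lev g (m j)); split.
  - exact: leq_trans (lev_le f jn) (ltnW fgj).
  - exact: lev_le.
  rewrite -(path_edges_cat C (lev_le f jn) (ltnW fgj)) ecompA.
  rewrite -pedge_comm_le // -ecompA -H ecompA path_edges_cat ?(ltnW nmj) //.
  exact: pedge_comm_le.
pose st n m := [/\ n < m, lev f n < lev g m & path_edges B n m ∘ pedge g m ≅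
  pedge f n ∘ path_edges C (lev f n) (lev g m)].
pose ts m n := [/\ m < n, lev g m < lev f n & path_edges B m n ∘ pedge f n ≅
  pedge g m ∘ path_edges C (lev g m) (lev f n)].
have exS n : exists m, st n m by exact: pm_agree_step.
have exT m : exists n, ts m n by apply: pm_agree_step; exact: pm_agree_sym.
have [a aP] := choice exS; have [b bP] := choice exT.
pose n := fix n k := if k is k'.+1 then b (a (n k')) else 1.
exists n, (a \o n); split => //= k.
- by have [-> _ _] := aP (n k); have [-> _ _] := bP (a (n k)).
- by have [_ -> _] := aP (n k); have [_ -> _] := bP (a (n k)).
- by have [_ _] := aP (n k).
- by have [_ _] := bP (a (n k)).
Qed.

Lemma pm_agree_refl (B C : obd) (f : premorphism B C) : pm_agree f f.
Proof. by move=> n; exists (lev f n). Qed.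

Lemma pm_agree_trans (B C : obd) (f g h : premorphism B C) :
  pm_agree f g -> pm_agree g h -> pm_agree f h.
Proof.
move=> fg gh n; have [k [fk gk H]] := fg n; have [l [gl hl K]] := gh n.
exists (maxn k l); have [kx lx] := (leq_maxl k l, leq_maxr k l); split.
- exact: leq_trans kx.
- exact: leq_trans lx.
rewrite -(path_edges_cat C fk kx) ecompA H -ecompA path_edges_cat //.
by rewrite -(path_edges_cat C gl lx) ecompA K -ecompA path_edges_cat.
Qed.

Lemma pm_equiv_refl (B C : obd) (f : premorphism B C) : pm_equiv f f.
Proof. exact/pm_equivP/pm_agree_refl. Qed.

Lemma pm_equiv_sym (B C : obd) (f g : premorphism B C) :
  pm_equiv f g -> pm_equiv g f.
Proof. by move=> /pm_equivP/pm_agree_sym/pm_equivP. Qed.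

Lemma pm_equiv_trans (B C : obd) (f g h : premorphism B C) :
  pm_equiv f g -> pm_equiv g h -> pm_equiv f h.
Proof.
by move=> /pm_equivP fg /pm_equivP gh; apply/pm_equivP; exact: pm_agree_trans gh.
Qed.

End Premorphisms.

Section Identity.
Variable B : obd.
Let F n := path_edges B n n.

Lemma pm_id_lev_unbounded N : exists n : nat, N <= n.
Proof. by exists N. Qed.

Lemma pm_id_src_surj n : src_surj (F n).
Proof. exact: path_edges_src_surj. Qed.

Lemma pm_id_rng_surj n : rng_surj (F n).
Proof.
rewrite /F path_edges_diag => v.
by exists (exist _ (v, v) (eqxx (Tagged (V B) v))).
Qed.

Lemma pm_id_nonempty n : 0 < #|F n|.
Proof.
have /card_gt0P[v _] := V_nonempty B n; have [e _] := pm_id_src_surj v.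
by apply/card_gt0P; exists e.
Qed.

Lemma pm_id_singleton : #|F 0| = 1.
Proof.
apply/eqP; rewrite eqn_leq pm_id_nonempty andbT; apply/card_le1_eqP => p q _ _.
have /fintype_le1P V1 : #|V B 0| <= 1 by rewrite V0_singleton.
by apply: val_inj; case: (val p) (val q) => [a b] [c d]; rewrite (V1 a c) (V1 b d).
Qed.

Lemma pm_id_comm n : E B n ∘ F n.+1 ≅ F n ∘ path_edges B n n.+1.
Proof.
by rewrite /F (@path_edges_recr _ n n (leqnn n)) !path_edges_diag ecompe1 !ecomp1e.
Qed.

Definition pm_id : premorphism B B :=
  @Premorphism B B id F erefl leqnSn pm_id_lev_unbounded
    pm_id_nonempty pm_id_src_surj pm_id_rng_surj pm_id_singleton pm_id_comm.

End Identity.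

Section Composition.
Variables (B C D : obd) (f : premorphism B C) (g : premorphism C D).
Let h n := lev g (lev f n).
Let H n := pedge f n ∘ pedge g (lev f n).

Lemma pm_comp_lev0 : h 0 = 0.
Proof. by rewrite /h !lev0. Qed.

Lemma pm_comp_lev_mono n : h n <= h n.+1.
Proof. exact/lev_le/lev_mono. Qed.

Lemma pm_comp_lev_unbounded N : exists n, N <= h n.
Proof.
have [m Nm] := lev_unbounded g N; have [n mn] := lev_unbounded f m.
by exists n; apply: leq_trans Nm (lev_le g mn).
Qed.

Lemma pm_comp_src_surj n : src_surj (H n).
Proof.
move=> v; have [e <-] := @pedge_src_surj _ _ f n v.
have [e' h'] := @pedge_src_surj _ _ g _ (rng _ e).
by exists (exist _ (e, e') (introT eqP (esym h'))).
Qed.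

Lemma pm_comp_rng_surj n : rng_surj (H n).
Proof.
move=> v; have [e <-] := @pedge_rng_surj _ _ g _ v.
have [e' h'] := @pedge_rng_surj _ _ f n (src _ e).
by exists (exist _ (e', e) (introT eqP h')).
Qed.

Lemma pm_comp_nonempty n : 0 < #|H n|.
Proof.
have /card_gt0P[v _] := V_nonempty B n; have [e _] := pm_comp_src_surj v.
by apply/card_gt0P; exists e.
Qed.

Lemma pm_comp_singleton : #|H 0| = 1.
Proof.
apply/eqP; rewrite eqn_leq pm_comp_nonempty andbT.
apply/card_le1_eqP => p q _ _; apply: val_inj.
have /fintype_le1P F1 : #|pedge f 0| <= 1 by rewrite pedge0_singleton.
have /fintype_le1P G1 : #|pedge g (lev f 0)| <= 1.
  by rewrite lev0 pedge0_singleton.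
by case: (val p) (val q) => [a b] [c d]; rewrite (F1 a c) (G1 b d).
Qed.

Lemma pm_comp_comm n : E B n ∘ H n.+1 ≅ H n ∘ path_edges D (h n) (h n.+1).
Proof.
rewrite /H ecompA pedge_comm -ecompA pedge_comm_le ?lev_mono // ecompA.
by [].
Qed.

Definition pm_comp : premorphism B D :=
  @Premorphism B D h H pm_comp_lev0 pm_comp_lev_mono pm_comp_lev_unbounded
    pm_comp_nonempty pm_comp_src_surj pm_comp_rng_surj pm_comp_singleton
    pm_comp_comm.

End Composition.

Lemma pm_comp_equiv (B C D : obd) (f f' : premorphism B C)
    (g g' : premorphism C D) :
  pm_equiv f f' -> pm_equiv g g' -> pm_equiv (pm_comp f g) (pm_comp f' g').
Proof.
move=> /pm_equivP ff /pm_equivP gg; apply/pm_equivP => n /=.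
have [k [fk f'k Hf]] := ff n; have [l [gl g'l Hg]] := gg k.
exists l; split.
- exact: leq_trans (lev_le g fk) gl.
- exact: leq_trans (lev_le g' f'k) g'l.
rewrite -(path_edges_cat D (lev_le g fk) gl) -(path_edges_cat D (lev_le g' f'k) g'l).
rewrite -!ecompA (ecompA (pedge g _)) -(pedge_comm_le g fk).
rewrite (ecompA (pedge g' _)) -(pedge_comm_le g' f'k).
by rewrite -!ecompA Hg !ecompA Hf.
Qed.

Lemma pm_equiv_pointwise (B C : obd) (l : nat -> nat) (f g : premorphism B C)
    (fl : lev f = l) (gl : lev g = l) :
  (forall n, pedge f n ∘ path_edges C (lev f n) (lev f n) ≅
             pedge g n ∘ path_edges C (lev g n) (lev f n)) -> pm_equiv f g.
Proof.
by move=> H; apply/pm_equivP => n; exists (lev f n); split=> //; rewrite gl fl.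
Qed.

Lemma pm_comp1m (B C : obd) (f : premorphism B C) :
  pm_equiv (pm_comp (pm_id B) f) f.
Proof.
apply: (@pm_equiv_pointwise _ _ (lev f)) => //= n.
by rewrite (path_edges_diag B) ecomp1e.
Qed.

Lemma pm_compm1 (B C : obd) (f : premorphism B C) :
  pm_equiv (pm_comp f (pm_id C)) f.
Proof.
apply: (@pm_equiv_pointwise _ _ (lev f)) => //= n.
by rewrite path_edges_diag !ecompe1.
Qed.

Lemma pm_compA (A B C D : obd) (f : premorphism A B) (g : premorphism B C)
    (h : premorphism C D) :
  pm_equiv (pm_comp f (pm_comp g h)) (pm_comp (pm_comp f g) h).
Proof.
apply: (@pm_equiv_pointwise _ _ (lev h \o lev g \o lev f)) => //= n.
by rewrite ecompA.
Qed.

(* Morphisms are literally equivalence classes of premorphisms. [premorphism B C]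
   quantifies over finite types, so for universe reasons it cannot be given the
   [choiceType] structure that {eq_quot _} requires. *)
Record obd_hom (B C : obd) := OBDHom {
  members : premorphism B C -> Prop;
  members_class : exists f, members = pm_equiv f }.

Definition obd_class (B C : obd) (f : premorphism B C) : obd_hom B C :=
  @OBDHom B C (pm_equiv f) (ex_intro _ f erefl).

Lemma obd_hom_ext (B C : obd) (u v : obd_hom B C) :
  (forall f, members u f <-> members v f) -> u = v.
Proof.
case: u v => [u uP] [v vP] /= uv.
have E : u = v by apply: funext => f; exact: propext.
by subst v; congr OBDHom; exact: Prop_irrelevance.
Qed.

Lemma obd_classP (B C : obd) (f g : premorphism B C) :
  obd_class f = obd_class g <-> pm_equiv f g.
Proof.
split=> [/(congr1 (@members B C)) /= ->|fg]; first exact: pm_equiv_refl.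
apply: obd_hom_ext => h /=; split; last exact: pm_equiv_trans.
exact/pm_equiv_trans/pm_equiv_sym.
Qed.

Lemma obd_hom_class (B C : obd) (u : obd_hom B C) : exists f, u = obd_class f.
Proof.
by case: u => [u [f uf]]; exists f; apply: obd_hom_ext => h /=; rewrite uf.
Qed.

Section OBDComp.
Variables (B C D : obd) (u : obd_hom B C) (v : obd_hom C D).

Definition obd_comp_members (h : premorphism B D) : Prop :=
  exists f g, [/\ members u f, members v g & pm_equiv (pm_comp f g) h].

Lemma obd_comp_members_class : exists h, obd_comp_members = pm_equiv h.
Proof.
have [f uf] := members_class u; have [g vg] := members_class v.
exists (pm_comp f g); apply: funext => h; apply: propext; split.
  rewrite /obd_comp_members uf vg => -[f' [g' [ff' gg']]].
  exact/pm_equiv_trans/pm_comp_equiv.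
by move=> H; exists f, g; rewrite uf vg; split=> //; exact: pm_equiv_refl.
Qed.

Definition obd_comp : obd_hom B D := OBDHom obd_comp_members_class.

End OBDComp.

Lemma obd_comp_class (B C D : obd) (f : premorphism B C) (g : premorphism C D) :
  obd_comp (obd_class f) (obd_class g) = obd_class (pm_comp f g).
Proof.
apply: obd_hom_ext => h /=; split.
  by move=> [f' [g' [ff' gg']]]; exact/pm_equiv_trans/pm_comp_equiv.
by move=> H; exists f, g; split=> //; exact: pm_equiv_refl.
Qed.

Lemma obd_comp1m (B C : obd) (u : obd_hom B C) :
  obd_comp (obd_class (pm_id B)) u = u.
Proof.
by have [f ->] := obd_hom_class u; rewrite obd_comp_class; exact/obd_classP/pm_comp1m.
Qed.

Lemma obd_compm1 (B C : obd) (u : obd_hom B C) :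
  obd_comp u (obd_class (pm_id C)) = u.
Proof.
by have [f ->] := obd_hom_class u; rewrite obd_comp_class; exact/obd_classP/pm_compm1.
Qed.

Lemma obd_compA (A B C D : obd) (u : obd_hom A B) (v : obd_hom B C)
    (w : obd_hom C D) :
  obd_comp u (obd_comp v w) = obd_comp (obd_comp u v) w.
Proof.
have [f ->] := obd_hom_class u; have [g ->] := obd_hom_class v.
have [h ->] := obd_hom_class w; rewrite !obd_comp_class.
exact/obd_classP/pm_compA.
Qed.

Definition OBD : category :=
  @Category obd obd_hom (fun B => obd_class (pm_id B)) obd_comp
    obd_comp1m obd_compm1 obd_compA.

Definition OBDpo : category := @full_subcategory OBD properly_ordered.

Definition homeomorphism (X Y : topologicalType) (f : X -> Y) : Prop :=
  continuous f /\ exists g : Y -> X, [/\ continuous g, cancel f g & cancel g f].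

Definition metrizable (R : realType) (X : topologicalType) : Prop :=
  exists (M : metricType R) (f : X -> M), homeomorphism f.

Section Dynamics.
Variables (X : topologicalType) (phi : X -> X).

(* [phi] is meant to be a homeomorphism, and Y invariant means phi(Y) = Y. *)
Definition minimal_subset (Y : set X) : Prop :=
  [/\ Y !=set0, closed Y, phi @` Y = Y &
      forall Y' : set X, Y' !=set0 -> closed Y' -> phi @` Y' = Y' ->
        Y' `<=` Y -> Y' = Y].

Definition minimal_system : Prop := minimal_subset [set: X].

(* The set Z(k,j), 1 <= j <= J(k), is [kr_set k j.-1]; values of [kr_set k] at
   indices beyond J(k) carry no meaning. *)
Record kr_partition (x0 : X) := KRPartition {
  kr_num : nat;
  kr_height : 'I_kr_num -> nat;
  kr_set : 'I_kr_num -> nat -> set X;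
  kr_index : set ('I_kr_num * nat) := [set i | i.2 < kr_height i.1];
  kr_top : set X := \bigcup_k kr_set k (kr_height k).-1;
  kr_height_gt0 : forall k, 0 < kr_height k;
  kr_partitionP : partition kr_index (fun i => kr_set i.1 i.2) [set: X];
  kr_clopen : forall k j, j < kr_height k -> clopen (kr_set k j);
  kr_step : forall k j, j.+1 < kr_height k ->
    phi @` kr_set k j = kr_set k j.+1;
  kr_top_x0 : kr_top x0;
  kr_top_image : phi @` kr_top = \bigcup_k kr_set k 0 }.

Arguments kr_height {x0}.
Arguments kr_set {x0}.
Arguments kr_index {x0}.
Arguments kr_top {x0}.

Definition kr_parts (x0 : X) (P : kr_partition x0) : set (set X) :=
  [set kr_set P i.1 i.2 | i in kr_index P].

Definition kr_refines (x0 : X) (P Q : kr_partition x0) : Prop :=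
  forall A, kr_parts P A -> exists2 A', kr_parts Q A' & A `<=` A'.

Definition kr_system (x0 : X) (R : nat -> kr_partition x0) : Prop :=
  [/\ kr_parts (R 0) = [set [set: X]],
      forall n, kr_refines (R n.+1) (R n),
      forall n, 0 < n -> kr_top (R n.+1) `<=` kr_top (R n),
      \bigcap_(n in [set n | 0 < n]) kr_top (R n) = [set x0]
    & basis (\bigcup_n kr_parts (R n))].

End Dynamics.

Record sds (R : realType) := SDSystem {
  space :> topologicalType;
  dyn : space -> space;
  base : space;
  kr : nat -> kr_partition dyn base;
  space_metrizable : metrizable R space;
  space_compact : compact [set: space];
  space_totally_disconnected : totally_disconnected [set: space];
  dyn_homeo : homeomorphism dyn;
  dyn_base : exists! Y : set space, minimal_subset dyn Y;
  base_minimal : forall Y : set space, minimal_subset dyn Y -> Y base;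
  kr_systemP : kr_system kr }.

Record sds_hom (R : realType) (X Y : sds R) := SDSHom {
  sds_map :> X -> Y;
  sds_map_continuous : continuous sds_map;
  sds_map_dyn : forall x, sds_map (dyn x) = dyn (sds_map x);
  sds_map_base : sds_map (base X) = base Y }.

Lemma sds_hom_ext (R : realType) (X Y : sds R) (a b : sds_hom X Y) :
  a =1 b -> a = b.
Proof.
case: a b => [a a1 a2 a3] [b b1 b2 b3] /= /funext ab; subst b.
by congr SDSHom; exact: Prop_irrelevance.
Qed.

Section SDSCategory.
Variable R : realType.

Definition sds_id (X : sds R) : sds_hom X X :=
  @SDSHom R X X id (fun x => cvg_id) (fun x => erefl) erefl.

Section Comp.
Variables (X Y Z : sds R) (a : sds_hom X Y) (b : sds_hom Y Z).

Lemma sds_comp_continuous : continuous (b \o a).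
Proof.
by move=> x; apply: continuous_comp; exact: sds_map_continuous.
Qed.

Lemma sds_comp_dyn x : (b \o a) (dyn x) = dyn ((b \o a) x).
Proof. by rewrite /= !sds_map_dyn. Qed.

Lemma sds_comp_base : (b \o a) (base X) = base Z.
Proof. by rewrite /= !sds_map_base. Qed.

Definition sds_comp : sds_hom X Z :=
  SDSHom sds_comp_continuous sds_comp_dyn sds_comp_base.

End Comp.

Lemma sds_comp1m (X Y : sds R) (a : sds_hom X Y) : sds_comp (sds_id X) a = a.
Proof. exact: sds_hom_ext. Qed.

Lemma sds_compm1 (X Y : sds R) (a : sds_hom X Y) : sds_comp a (sds_id Y) = a.
Proof. exact: sds_hom_ext. Qed.

Lemma sds_compA (X Y Z T : sds R) (a : sds_hom X Y) (b : sds_hom Y Z)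
    (c : sds_hom Z T) :
  sds_comp a (sds_comp b c) = sds_comp (sds_comp a b) c.
Proof. exact: sds_hom_ext. Qed.

Definition SDS : category :=
  @Category (sds R) (@sds_hom R) sds_id sds_comp sds_comp1m sds_compm1 sds_compA.

End SDSCategory.

Definition cantor_set (X : topologicalType) : Prop :=
  exists f : X -> cantor_space, homeomorphism f.

(* Main.v *)
From HB Require Import structures.
Require Import Defs.
From mathcomp Require Import all_boot all_order all_algebra.
From mathcomp Require Import all_classical all_reals topology cantor.

(* An ordered edge set is determined up to isomorphism by its words: the word of
   a vertex w lists the sources of the edges ending at w in increasing order.
   Composition of edge sets becomes substitution of words, so a premorphism is a
   compatible family of substitutions. A point of the path space of B is read off
   as a sequence of addresses, its address at level n being the vertex reached at
   level n together with the rank of its initial segment among all paths ending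
   there; the Vershik map moves up one floor in every tower in which this is
   possible. A premorphism f : B -> C sends a path of C to the path of B obtained
   by locating its floor in the substituted towers. The word of a tower can be
   recovered from the sequence of floors it traverses, since towers are traversed
   completely and each starts at its unique bottom floor; this gives faithfulness.
   A continuous equivariant map, or a refinement of Kakutani-Rokhlin partitions,
   likewise makes every fine tower traverse complete coarse towers as soon as fine
   tops lie in coarse tops, which gives fullness and essential surjectivity. *)

Set Implicit Arguments.
Unset Strict Implicit.
Unset Printing Implicit Defensive.

Import Order.TTheory GRing.Theory Num.Theory.

Local Open Scope classical_set_scope.
Local Open Scope nat_scope.

(** * Words of ordered edge sets *)

(** Two requirements in the definitions shape the argument. A premorphism must use every vertex as a
    source, so only a surjective map can come from one; here surjectivity is automatic, because the
    image of an equivariant map is a non-empty closed invariant subset of a minimal system. In a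
    composite edge set the later edge is the most significant, so the paths with a given last edge
    occupy consecutive positions; stacking towers mirrors this, and maximal paths are those that
    stay on top floors. Simplicity bounds the time in which every orbit reaches a given floor, which
    yields minimality and, if the path space is infinite, the absence of isolated points. Morphisms
    of systems ignore the chosen partitions, so the diagram built from one system of partitions only
    has to recover the space, the map and the base point. *)

Section Words.
Variables (S T : finType).
Implicit Type F : edge_set S T.

Definition fibre F (w : T) : seq F :=
  sort (ele F) [seq e <- enum F | rng F e == w].

Definition word F (w : T) : seq S := [seq src F e | e <- fibre F w].

Lemma mem_fibre F w e : (e \in fibre F w) = (rng F e == w).
Proof. by rewrite mem_sort mem_filter mem_enum andbT. Qed.

Lemma fibre_uniq F w : uniq (fibre F w).
Proof. by rewrite sort_uniq filter_uniq // enum_uniq. Qed.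

Lemma fibre_sorted F w : sorted (ele F) (fibre F w).
Proof.
apply: (@sort_sorted_in _ [pred e | rng F e == w]).
  by move=> e e' /= /eqP ew /eqP e'w; rewrite ele_comparable ew e'w.
exact: filter_all.
Qed.

Lemma ele_index F w e e' : rng F e = w -> rng F e' = w ->
  ele F e e' = (index e (fibre F w) <= index e' (fibre F w)).
Proof.
move=> ew e'w.
have le f f' : rng F f = w -> rng F f' = w ->
    index f (fibre F w) <= index f' (fibre F w) -> ele F f f'.
  move=> fw f'w; apply: (sorted_leq_index (@ele_trans _ _ F) (@ele_refl _ _ F)).
  - exact: fibre_sorted.
  - by rewrite mem_fibre fw.
  - by rewrite mem_fibre f'w.
apply/idP/idP => [ee'|]; last exact: le.
case: leqP => // lt; have e'e := le _ _ e'w ew (ltnW lt).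
suff E : e = e' by rewrite E ltnn in lt.
by apply: (@ele_anti _ _ F); rewrite ee'.
Qed.

Lemma index_fibre F w e : (index e (fibre F w) < size (word F w)) = (rng F e == w).
Proof. by rewrite size_map index_mem mem_fibre. Qed.

Lemma fibre_of_index F w i : i < size (word F w) ->
  exists2 e, rng F e = w & index e (fibre F w) = i.
Proof.
rewrite size_map; case E : (fibre F w) => [|e0 s] // => ilt; rewrite -E in ilt *.
exists (nth e0 (fibre F w) i); last by rewrite index_uniq // fibre_uniq.
by apply/eqP; rewrite -mem_fibre mem_nth.
Qed.

Lemma nth_word F x0 w e : rng F e = w ->
  nth x0 (word F w) (index e (fibre F w)) = src F e.
Proof.
by move=> ew; rewrite (nth_map e) ?nth_index ?index_mem // mem_fibre ew.
Qed.

Lemma mem_word F v w :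
  reflect (exists e, src F e = v /\ rng F e = w) (v \in word F w).
Proof.
apply: (iffP mapP) => [[e + ->]|[e [<- <-]]].
  by rewrite mem_fibre => /eqP; exists e.
by exists e; rewrite // mem_fibre.
Qed.

Lemma eiso_word F F' : F ≅ F' -> word F =1 word F'.
Proof.
move=> [h [[k hK kK] hs hr hl]] w.
suff E : fibre F' w = map h (fibre F w).
  by rewrite /word E -map_comp; apply: eq_map => e /=; rewrite hs.
apply: (sorted_eq (@ele_trans _ _ F') (@ele_anti _ _ F')).
- exact: fibre_sorted.
- by rewrite sorted_map (@eq_sorted _ _ (ele F)) ?fibre_sorted.
apply: uniq_perm; first exact: fibre_uniq.
  by rewrite (map_inj_uniq (can_inj hK)) fibre_uniq.
move=> e; rewrite mem_fibre; apply/eqP/mapP => [er|[e' + ->]].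
  by exists (k e); rewrite ?kK // mem_fibre -hr kK er.
by rewrite mem_fibre hr => /eqP.
Qed.

(** An edge is determined by its range and its position in the fibre, and equal words have equal
    lengths. Matching range and position is therefore a bijection, and reading the letter at that
    position shows that sources agree. *)
Lemma word_eiso F F' : word F =1 word F' -> F ≅ F'.
Proof.
move=> FF'.
have tr (G G' : edge_set S T) : word G =1 word G' -> exists h : G -> G', forall e,
    rng G' (h e) = rng G e /\
    index (h e) (fibre G' (rng G e)) = index e (fibre G (rng G e)).
  move=> GG'; suff ex e : exists e', rng G' e' = rng G e /\
      index e' (fibre G' (rng G e)) = index e (fibre G (rng G e)).
    by have [h hP] := choice ex; exists h.
  have : index e (fibre G (rng G e)) < size (word G' (rng G e)).
    by rewrite -GG' index_fibre.
  by move=> /fibre_of_index[e' ? ?]; exists e'.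
have [h hP] := tr _ _ FF'; have [k kP] := tr _ _ (fsym FF').
have idx_inj (G : edge_set S T) (e e' : G) : rng G e = rng G e' ->
    index e (fibre G (rng G e)) = index e' (fibre G (rng G e)) -> e = e'.
  move=> r /(congr1 (nth e (fibre G (rng G e)))).
  by rewrite !nth_index // mem_fibre ?r.
have can (G G' : edge_set S T) (f : G -> G') (g : G' -> G)
    (fP : forall e, rng G' (f e) = rng G e /\
      index (f e) (fibre G' (rng G e)) = index e (fibre G (rng G e)))
    (gP : forall e, rng G (g e) = rng G' e /\
      index (g e) (fibre G (rng G' e)) = index e (fibre G' (rng G' e))) :
    cancel f g.
  move=> e; have [fr fi] := fP e; have [gr gi] := gP (f e).
  by apply: idx_inj; rewrite gr // gi fr fi.
exists h; split.
- by exists k; [exact: can | exact: can].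
- move=> e; have [hr hi] := hP e.
  by rewrite -(nth_word (src F e) hr) hi -FF' nth_word.
- by move=> e; have [] := hP e.
- move=> e e'; have [hr hi] := hP e; have [hr' hi'] := hP e'.
  case: (eqVneq (rng F e) (rng F e')) => [r|/negbTE r].
    rewrite (ele_index (w := rng F e)) // ?hr' ?r //.
    by rewrite hi' -r hi (ele_index (w := rng F e)).
  have := ele_comparable e e'; have := ele_comparable (h e) (h e').
  by rewrite hr hr' r => /norP[/negbTE -> _] /norP[/negbTE -> _].
Qed.

End Words.

Section WordComposite.
Variables (S T U : finType) (F : edge_set S T) (G : edge_set T U).

(** The order of [F ∘ G] extended to all pairs, composable or not, so that [pairs] can be compared
    with the fibre outside the subtype. *)
Let le2 (p q : F * G) : bool :=
  ((p.2 != q.2) && ele G p.2 q.2) || ((p.2 == q.2) && ele F p.1 q.1).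

Let le2_anti : antisymmetric le2.
Proof.
move=> [e g] [e' g']; rewrite /le2 /= (eq_sym g').
case: (eqVneq g g') => [->|ne] /=; first by move=> /ele_anti ->.
by rewrite !orbF => /ele_anti E; rewrite E eqxx in ne.
Qed.

Let le2_trans : transitive le2.
Proof.
move=> [e g] [e1 g1] [e2 g2]; rewrite /le2 /=.
move=> /orP[/andP[n1 l1]|/andP[/eqP -> l1]] /orP[/andP[n2 l2]|/andP[/eqP E2 l2]].
- rewrite (ele_trans l1 l2) andbT; case: (eqVneq g1 g2) => //= E.
  by move: n2; rewrite -E (@ele_anti _ _ G g g1) ?eqxx // l1 andbT E l2.
- by rewrite -E2 n1 l1.
- by rewrite n2 l2.
- by rewrite E2 eqxx (ele_trans l1 l2) orbT.
Qed.

Let pairs (u : U) : seq (F * G) :=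
  [seq (e, g) | g <- fibre G u, e <- fibre F (src G g)].

Let pairs_sorted u : sorted le2 (pairs u).
Proof.
rewrite sorted_pairwise //; have := fibre_uniq G u; have := fibre_sorted G u.
rewrite /pairs sorted_pairwise; last exact: ele_trans.
elim: (fibre G u) => //= g s IH /andP[gs ss] /andP[gNs us].
rewrite pairwise_cat IH // andbT; apply/andP; split.
  apply/allrelP => p q /mapP[e _ ->] /allpairsPdep[g' [e' [g's _ ->]]].
  rewrite /le2 /= (allP gs) // andbT; case: eqP => //= gg'.
  by rewrite gg' g's in gNs.
rewrite pairwise_map; apply: (@sub_pairwise _ (ele F)).
  by move=> e e' ee'; rewrite /le2 /= eqxx ee'.
by rewrite -sorted_pairwise ?fibre_sorted //; exact: ele_trans.
Qed.

(** [pairs u] runs through the edges of G and, for each of them, through the edges of F below it,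
    which is increasing in the reverse lexicographic order; a sorted list without repetitions is
    determined by its members. *)
Lemma word_comp u : word (F ∘ G) u = flatten (map (word F) (word G u)).
Proof.
pose m (p : F ∘ G) : F * G := val p.
have E : map m (fibre (F ∘ G) u) = pairs u.
  apply: (sorted_eq le2_trans le2_anti) => //.
    rewrite sorted_map; apply: sub_sorted (fibre_sorted (F ∘ G) u).
    by move=> [[e g] h] [[e' g'] h'].
  apply: uniq_perm.
  - by rewrite map_inj_uniq ?fibre_uniq // => p q; exact: val_inj.
  - apply: allpairs_uniq_dep; first exact: fibre_uniq.
      by move=> *; exact: fibre_uniq.
    by move=> [g e] [g' e'] _ _ /= [-> ->].
  move=> [e g]; apply/mapP/allpairsPdep => [[[[e' g'] h]]|[g' [e' [g'u e'g [-> ->]]]]].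
    rewrite mem_fibre => /= /eqP gu [-> ->]; exists g', e'; split=> //.
      by rewrite mem_fibre gu.
    by rewrite mem_fibre.
  rewrite mem_fibre in e'g; exists (exist _ (e', g') e'g : F ∘ G) => //.
  by rewrite mem_fibre /= -mem_fibre.
rewrite /word.
transitivity (map (fun p : F * G => src F p.1) (pairs u)).
  by rewrite -E -map_comp.
by rewrite map_allpairs -map_comp.
Qed.

End WordComposite.

Lemma word_diag (V : nat -> finType) k v : word (ediag V k k) v = [:: v].
Proof.
suff E : fibre (ediag V k k) v = [:: ediag_id v] by rewrite /word E.
apply: (sorted_eq (@ele_trans _ _ (ediag V k k)) (@ele_anti _ _ (ediag V k k))) => //.
  exact: fibre_sorted.
apply: uniq_perm => //; first exact: fibre_uniq.
move=> p; rewrite mem_fibre inE; elim/ediag_ind: p => w /=.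
apply/eqP/eqP => [-> //|/(congr1 val)[]]; by [].
Qed.

(** * Edge sets with prescribed words *)

Section OfWords.
Variables (S T : finType) (u : T -> seq S).

Definition letter := {w : T & 'I_(size (u w))}.

Definition letter_le (p q : letter) : bool :=
  (tag p == tag q) && (tagged p <= tagged q).

Lemma letter_le_refl : reflexive letter_le.
Proof. by move=> p; rewrite /letter_le eqxx leqnn. Qed.

Lemma letter_le_anti : antisymmetric letter_le.
Proof.
move=> [w i] [w' j] /andP[/andP[/= /eqP ww' ij]]; subst w'; rewrite /letter_le eqxx.
by move=> /= ji; congr existT; apply/val_inj/eqP; rewrite eqn_leq ij.
Qed.

Lemma letter_le_trans : transitive letter_le.
Proof.
move=> [w i] [w' j] [w'' k] /andP[/= /eqP E1 ij] /andP[/= /eqP E2 jk].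
by apply/andP; split; [rewrite /= E1 E2 | exact: leq_trans ij jk].
Qed.

Lemma letter_le_comparable (p q : letter) :
  (letter_le p q || letter_le q p) = (tag p == tag q).
Proof.
rewrite /letter_le (eq_sym (tag q)).
by case: (tag p == tag q) => //=; exact: leq_total.
Qed.

(** The letter is read by [tnth], which needs no default element of the possibly empty type S. *)
Definition of_words : edge_set S T :=
  @EdgeSet S T letter (fun p => tnth (in_tuple (u (tag p))) (tagged p)) (@tag _ _)
    letter_le letter_le_refl letter_le_anti letter_le_trans letter_le_comparable.

Lemma word_of_words : word of_words =1 u.
Proof.
move=> w; pose s : seq of_words := [seq existT _ w i | i <- enum 'I_(size (u w))].
suff E : fibre of_words w = s.
  rewrite /word E -map_comp /=.
  rewrite (eq_map (g := tnth (in_tuple (u w)))) //.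
  by rewrite map_tnth_enum.
apply: (sorted_eq (@ele_trans _ _ of_words) (@ele_anti _ _ of_words)); first exact: fibre_sorted.
  rewrite sorted_map; have := iota_sorted 0 (size (u w)).
  rewrite -val_enum_ord sorted_map; apply: sub_sorted => i j /=.
  by rewrite /letter_le /= eqxx.
apply: uniq_perm; first exact: fibre_uniq.
  rewrite map_inj_uniq ?enum_uniq // => i j /eqP.
  by rewrite eq_Tagged => /eqP.
move=> p; rewrite mem_fibre; case: p => [w' i] /=; apply/eqP/mapP => [E|[j _ []] //].
by subst w'; exists i; rewrite ?mem_enum.
Qed.

Lemma of_words_src_surj : (forall v, exists w, v \in u w) -> src_surj of_words.
Proof.
move=> uP v; have [w] := uP v; rewrite -word_of_words => /mem_word[e [ev _]].
by exists e.
Qed.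

Lemma of_words_rng_surj : (forall w, u w != [::]) -> rng_surj of_words.
Proof.
move=> uP w; have := uP w; rewrite -word_of_words.
case E : (word of_words w) => [//|v s] _.
have : v \in word of_words w by rewrite E mem_head.
by move=> /mem_word[e [_ ew]]; exists e.
Qed.

End OfWords.

Lemma src_surj_nonempty (S T : finType) (F : edge_set S T) :
  0 < #|S| -> src_surj F -> 0 < #|F|.
Proof.
by move=> /card_gt0P[v _] Fs; have [e _] := Fs v; apply/card_gt0P; exists e.
Qed.

(** * Floors of towers *)

Section Floors.
Variables (T : eqType) (h : T -> nat).
Implicit Types (a b : T * nat) (u : seq T) (s : seq (T * nat)).

Definition tower (v : T) : seq (T * nat) := [seq (v, j) | j <- iota 0 (h v)].

Definition floors u : seq (T * nat) := flatten (map tower u).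

Definition floor a := a.2 < h a.1.
Definition top a := a.2.+1 == h a.1.
Definition bottom a := a.2 == 0.

(* The possible pairs of addresses of a point and its image under the dynamics in
   a Kakutani-Rokhlin partition with heights [h]. *)
Definition step a b := if a.2.+1 < h a.1 then b == (a.1, a.2.+1) else bottom b.

(** Each passage through a tower is counted once, at its bottom floor. *)
Definition letters s : seq T := [seq b.1 | b <- s & bottom b].

Hypothesis h_gt0 : forall v, 0 < h v.

Lemma floor_topN a : floor a -> (a.2.+1 < h a.1) = ~~ top a.
Proof. by rewrite /floor /top => fa; rewrite ltn_neqAle fa andbT. Qed.

Lemma top_floor a : top a -> floor a.
Proof. by rewrite /floor /top => /eqP ->. Qed.

Lemma step_top a b : top a -> step a b = bottom b.
Proof. by rewrite /step /top => /eqP ->; rewrite ltnn. Qed.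

Lemma stepN a b : floor a -> ~~ top a -> step a b = (b == (a.1, a.2.+1)).
Proof. by move=> fa /negbTE ta; rewrite /step floor_topN // ta. Qed.

Lemma step_bottom a b : floor a -> step a b -> bottom b = top a.
Proof.
move=> fa; rewrite /step floor_topN //; case: ifP => [ta /eqP -> |/negbFE -> ->] //.
by rewrite (negbTE ta).
Qed.

Lemma floors_cons v u : floors (v :: u) = tower v ++ floors u.
Proof. by []. Qed.

Lemma floors_flatten (us : seq (seq T)) : floors (flatten us) = flatten (map floors us).
Proof.
elim: us => //= u us IH; rewrite -IH /floors map_cat flatten_cat; by [].
Qed.

Lemma size_floors u : size (floors u) = sumn (map h u).
Proof.
by rewrite size_flatten /shape -map_comp; congr sumn; apply: eq_map => v;
  rewrite /= size_map size_iota.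
Qed.

Lemma mem_floors u a : (a \in floors u) = (a.1 \in u) && floor a.
Proof.
apply/flatten_mapP/andP => [[v vu /mapP[j]]|[au fa]].
  by rewrite mem_iota => /andP[_ jv] ->.
by exists a.1 => //; apply/mapP; exists a.2; rewrite ?mem_iota //; case: (a).
Qed.

Lemma tower_head v : tower v = (v, 0) :: [seq (v, j) | j <- iota 1 (h v).-1].
Proof. by rewrite /tower; case: (h v) (h_gt0 v). Qed.

(** With positive heights each tower contributes exactly one bottom floor. Hence [floors] is
    injective, which is how equalities of words are proved below. *)
Lemma floorsK : cancel floors letters.
Proof.
elim=> [//|v u IH]; rewrite floors_cons /letters filter_cat map_cat.
rewrite -/(letters (floors u)) IH tower_head /=; congr cons.
rewrite -[RHS]cat0s; congr cat; rewrite (eq_in_filter (a2 := pred0)) ?filter_pred0 //.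
by move=> a /mapP[j]; rewrite mem_iota => /andP[+ _] -> /=; case: j.
Qed.

(** The top floor [a] stands for an arbitrary predecessor: from it any bottom floor may be entered,
    so the statement passes through concatenation of towers. *)
Lemma floors_path u a : top a -> path step a (floors u) && top (last a (floors u)).
Proof.
have tw v k i : i + k.+1 = h v ->
    path step (v, i) [seq (v, j) | j <- iota i.+1 k] &&
    top (last (v, i) [seq (v, j) | j <- iota i.+1 k]).
  elim: k i => [|k IH] i; first by rewrite addn1 /top => /= ->.
  rewrite addnS -addSn => E /=; rewrite -andbA IH // andbT.
  by rewrite /step /= -E addnS ltnS addSn ltnS leq_addr /=.
elim: u a => [a ->//|v u IH] a ta.
rewrite floors_cons tower_head /= step_top // -/(bottom _) /=.
have /andP[p l] := tw v (h v).-1 0 (prednK (h_gt0 v)).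
by rewrite cat_path last_cat p /=; exact: IH.
Qed.

(** A step leaves a tower only from its top and enters one only at its bottom, so an itinerary from
    a bottom to a top contains no partial tower. *)
Lemma floors_letters d s :
  all floor s -> (forall i, i.+1 < size s -> step (nth d s i) (nth d s i.+1)) ->
  (0 < size s -> bottom (nth d s 0)) -> (0 < size s -> top (nth d s (size s).-1)) ->
  floors (letters s) = s.
Proof.
case: s => // a s /= /andP[fa fs] st /(_ isT) ba /(_ isT) tl.
have {st} : path step a s by apply/(pathP d) => i ilt; exact: (st i).
have {}tl : top (last a s) by rewrite (last_nth d).
have {}ba : a.2 = 0 by apply/eqP.
(* Generalised to itineraries that start inside a tower: what is left of that tower comes before the
   towers counted by [letters s]. *)
move=> ps; suff : a :: s = drop a.2 (tower a.1) ++ floors (letters s).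
  by rewrite ba drop0 {2}/letters /= /bottom ba eqxx -/(letters s) floors_cons => ->.
have dr b : floor b -> drop b.2 (tower b.1) =
    b :: drop b.2.+1 (tower b.1).
  move=> fb; rewrite (drop_nth b) ?size_map ?size_iota //; congr cons.
  by rewrite (nth_map 0) ?size_iota // nth_iota // add0n; case: (b).
elim: s a fa fs ps tl {ba} => [|b s IH] a fa /=.
  move=> _ _ ta; rewrite dr //= drop_oversize ?size_map ?size_iota //.
  by rewrite (eqP ta).
move=> /andP[fb fs] /andP[ab ps] tl; rewrite [in LHS](IH b) //.
rewrite (dr a) //=; congr cons; move: ab; rewrite /step /letters /=; case: ifP.
  by move=> _ /eqP ->; rewrite /bottom.
move=> nt bb; rewrite bb /= floors_cons (eqP bb) drop0 [in RHS]drop_oversize //.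
by rewrite size_map size_iota leqNgt nt.
Qed.

End Floors.

(** * Substitution of stacks of towers *)

Section Subst.
Variables (S T : eqType) (g : S -> nat) (h : T -> nat) (d : S * nat).
Variable t : T -> seq S.
Implicit Types (a b : T * nat) (u : seq T).

(** The fine tower [a.1] is cut into the stack of coarse towers [t a.1], so entry [a.2] of the stack
    is the coarse floor containing floor [a.2]; [d] is a default. *)
Definition subst_floor a : S * nat := nth d (floors g (t a.1)) a.2.

Definition height_compat := forall w, size (floors g (t w)) = h w.

Hypotheses (g_gt0 : forall v, 0 < g v) (tP : height_compat).

Lemma floors_subst u : floors g (flatten (map t u)) = map subst_floor (floors h u).
Proof.
rewrite floors_flatten {2}/floors map_flatten -!map_comp; congr flatten.
apply: eq_map => w /=; rewrite /tower -map_comp /= -tP.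
by rewrite -[LHS](mkseq_nth d).
Qed.

Lemma height_compat_neq_nil w : 0 < h w -> t w != [::].
Proof. by rewrite -tP; case: (t w). Qed.

Lemma subst_floor_mem a : floor h a -> subst_floor a \in floors g (t a.1).
Proof. by move=> fa; rewrite mem_nth ?tP. Qed.

Lemma subst_floorP a : floor h a -> floor g (subst_floor a).
Proof. by move/subst_floor_mem; rewrite mem_floors => /andP[]. Qed.

Lemma subst_floor_top a : top h a -> top g (subst_floor a).
Proof.
move=> ta; have fa := top_floor ta.
have := subst_floorP fa; rewrite /subst_floor.
have -> : a.2 = (size (floors g (t a.1))).-1 by rewrite tP -(eqP ta).
rewrite nth_last; have := tP a.1; rewrite -(eqP ta).
case E : (floors g (t a.1)) => [//|b s] _ /= fl.
(* [floors_path] asks for a top floor before the stack; any will do, and this one exists because [g]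
   is positive. *)
pose c := (b.1, (g b.1).-1).
have tc : top g c by rewrite /top /= prednK.
by have := floors_path g_gt0 (t a.1) tc; rewrite E => /andP[].
Qed.

Lemma subst_floor_bottom a : floor h a -> bottom a -> bottom (subst_floor a).
Proof.
move=> + ba; rewrite /subst_floor /floor (eqP ba) -tP.
by case: (t a.1) => //= v u _; rewrite floors_cons tower_head.
Qed.

Lemma subst_floor_step a b : floor h a -> floor h b -> step h a b ->
  step g (subst_floor a) (subst_floor b).
Proof.
move=> fa fb; case: (boolP (top h a)) => [ta|ta].
  rewrite step_top // => bb; rewrite step_top ?subst_floor_top //.
  exact: subst_floor_bottom.
rewrite stepN // => /eqP ->; rewrite /subst_floor /=.
have : a.2.+1 < size (floors g (t a.1)) by rewrite tP floor_topN.
case E : (floors g (t a.1)) => [//|b0 s] /= lt.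
pose c := (b0.1, (g b0.1).-1).
have tc : top g c by rewrite /top /= prednK.
have := floors_path g_gt0 (t a.1) tc; rewrite E /= => /andP[/andP[_ p] _].
exact: (pathP d p).
Qed.

End Subst.

Section SubstComp.
Variables (S T U : eqType) (g : S -> nat) (h : T -> nat) (k : U -> nat).
Variables (d : S * nat) (e : T * nat) (t : T -> seq S) (r : U -> seq T).
Hypotheses (tP : height_compat g h t) (rP : height_compat h k r).

Lemma subst_floor_comp a : floor k a ->
  subst_floor g d (fun w => flatten (map t (r w))) a =
  subst_floor g d t (subst_floor h e r a).
Proof.
by move=> fa; rewrite {1}/subst_floor (floors_subst d tP) (nth_map e) // rP.
Qed.

End SubstComp.

Lemma subst_floor_id (T : eqType) (h : T -> nat) d t a :
  t a.1 = [:: a.1] -> floor h a -> subst_floor h d t a = a.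
Proof.
move=> ta fa; rewrite /subst_floor ta /floors /= cats0 (nth_map 0) ?size_iota //.
by rewrite nth_iota //; case: (a).
Qed.

(** * Words read off from a dynamical system *)

Section WordsOf.
Variables (X : Type) (phi : X -> X) (S T : eqType) (g : S -> nat) (h : T -> nat).
Variables (d : S * nat) (c : X -> S * nat) (f : X -> T * nat).
Hypotheses (g_gt0 : forall v, 0 < g v) (h_gt0 : forall w, 0 < h w).
Hypotheses (cP : forall x, floor g (c x)).
Hypotheses (c_step : forall x, step g (c x) (c (phi x))).
Hypotheses (f_step : forall x, step h (f x) (f (phi x))).
Hypotheses (f_onto : forall a, floor h a -> exists x, f x = a).
Hypotheses (fc : forall x y, f x = f y -> c x = c y).
Hypotheses (fc_top : forall x, top h (f x) -> top g (c x)).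
Hypotheses (fc_bottom : forall x, bottom (f x) -> bottom (c x)).

(** One point is taken on each floor of the fine tower w. Its coarse address depends only on the
    floor by [fc]; the addresses form an itinerary by equivariance, which begins at a bottom and
    ends at a top by [fc_bottom] and [fc_top]. Its letters are the word of w. *)
Lemma tower_words : exists t : T -> seq S,
  height_compat g h t /\
  forall x, floor h (f x) -> c x = subst_floor g d t (f x).
Proof.
suff ex w : exists u, size (floors g u) = h w /\
    forall x, (f x).1 = w -> floor h (f x) -> c x = nth d (floors g u) (f x).2.
  have [t tP] := choice ex; exists t; split => [w|x]; first by have [] := tP w.
  by have [_] := tP (f x).1; apply.
have [x0 _] : exists x, f x = (w, 0) by apply: f_onto; exact: h_gt0.
have pt_ex j : exists x, j < h w -> f x = (w, j).
  case: (ltnP j (h w)) => jw; last by exists x0.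
  by have /f_onto[x fx] : floor h (w, j) by []; exists x.
have [pt ptP] := choice pt_ex.
pose s := [seq c (pt j) | j <- iota 0 (h w)].
have ss : size s = h w by rewrite size_map size_iota.
have sE j : j < h w -> nth d s j = c (pt j).
  by move=> jw; rewrite (nth_map 0) ?size_iota // nth_iota.
have E : floors g (letters s) = s.
  apply: (@floors_letters _ _ d).
  - by apply/allP => a /mapP[j _ ->]; exact: cP.
  - rewrite ss => i iw; rewrite !sE ?(ltnW iw) //.
    (* [phi (pt i)] need not be [pt i.+1], but it lies on the same fine floor. *)
    have -> : c (pt i.+1) = c (phi (pt i)); last exact: c_step.
    apply: fc; rewrite ptP //; have := f_step (pt i); rewrite ptP ?(ltnW iw) //.
    by rewrite /step /= iw => /eqP ->.
  - by rewrite ss => w0; rewrite sE //; apply: fc_bottom; rewrite ptP.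
  - rewrite ss => w0; rewrite sE ?prednK //; apply: fc_top.
    by rewrite ptP ?prednK // /top /= prednK.
exists (letters s); rewrite E ss; split=> // x fx fl; rewrite sE; last by rewrite -fx.
by apply: fc; rewrite ptP -fx //; case: (f x).
Qed.

End WordsOf.

(** * The path space as a limit of towers *)

Section Substitutions.
Variable B : obd.
Implicit Types k l m n : nat.

Definition sub k l (v : V B l) : seq (V B k) := word (path_edges B k l) v.

(** The number of paths from the root to v: level 0 is a single vertex, and [sub 0 v] has one letter
    per path. *)
Definition height n (v : V B n) : nat := size (sub 0 v).

Definition origin n : V B n * nat := (enum_val (Ordinal (V_nonempty B n)), 0).

Definition proj m n : V B n * nat -> V B m * nat :=
  subst_floor (@height m) (origin m) (@sub m n).

Lemma sub_id k (v : V B k) : sub k v = [:: v].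
Proof. by rewrite /sub path_edges_diag word_diag. Qed.

Lemma sub_comp k l m (v : V B m) : k <= l -> l <= m ->
  sub k v = flatten (map (@sub k l) (sub l v)).
Proof.
by move=> kl lm; rewrite /sub -(eiso_word (path_edges_cat B kl lm)) word_comp.
Qed.

Lemma sub_edge n : @sub n n.+1 =1 word (E B n).
Proof.
move=> v; rewrite /sub (path_edges_recr B (leqnn n)) path_edges_diag.
by rewrite (eiso_word (ecomp1e (E B n))).
Qed.

Lemma mem_sub_ex m n (v : V B m) : m <= n -> exists w : V B n, v \in sub m w.
Proof.
move=> mn; have [e ev] := path_edges_src_surj mn v.
by exists (rng _ e); apply/mem_word; exists e.
Qed.

(** The paths from the root to v are grouped according to their final segment from level m to v. *)
Lemma height_compat_sub m n : m <= n ->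
  height_compat (@height m) (@height n) (@sub m n).
Proof.
move=> mn v; rewrite size_floors /height (sub_comp v (leq0n m) mn).
by rewrite size_flatten /shape -map_comp.
Qed.

Lemma height0 (v : V B 0) : height v = 1.
Proof. by rewrite /height sub_id. Qed.

Lemma height_gt0 n (v : V B n) : 0 < height v.
Proof.
elim: n v => [|n IH] v; first by rewrite height0.
rewrite -(height_compat_sub (leqnSn n)) size_floors sub_edge.
have [e <-] := @E_rng_surj B n v.
have : src (E B n) e \in word (E B n) (rng (E B n) e).
  by apply/mem_word; exists e.
by case: (word _ _) => //= w s _; rewrite addn_gt0 IH.
Qed.

Lemma proj_id n a : floor (@height n) a -> proj n a = a.
Proof. exact/subst_floor_id/sub_id. Qed.

Lemma proj_floor m n a : m <= n -> floor (@height n) a ->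
  floor (@height m) (proj m a).
Proof. by move=> mn; apply: subst_floorP; exact: height_compat_sub. Qed.

Lemma proj_comp k l m a : k <= l -> l <= m -> floor (@height m) a ->
  proj k (proj l a) = proj k a.
Proof.
move=> kl lm fa; have kml := height_compat_sub kl; have lml := height_compat_sub lm.
rewrite /proj -(subst_floor_comp _ _ kml lml fa) /subst_floor.
by rewrite (sub_comp _ kl lm).
Qed.

Lemma proj_top m n a : m <= n -> top (@height n) a -> top (@height m) (proj m a).
Proof.
by move=> mn; apply: subst_floor_top; [exact: height_gt0 | exact: height_compat_sub].
Qed.

Lemma proj_bottom m n a : m <= n -> floor (@height n) a -> bottom a ->
  bottom (proj m a).
Proof.
by move=> mn; apply: subst_floor_bottom; [exact: height_gt0 | exact: height_compat_sub].
Qed.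

Lemma proj_step m n a b : m <= n ->
  floor (@height n) a -> floor (@height n) b ->
  step (@height n) a b -> step (@height m) (proj m a) (proj m b).
Proof.
by move=> mn; apply: subst_floor_step; [exact: height_gt0 | exact: height_compat_sub].
Qed.

Lemma floor_root a b : floor (@height 0) a -> floor (@height 0) b -> a = b.
Proof.
case: a b => [v i] [w j]; rewrite /floor /= !height0 !ltnS !leqn0 => /eqP -> /eqP ->.
have /fintype_le1P V1 : #|V B 0| <= 1 by rewrite V0_singleton.
by rewrite (V1 v w).
Qed.

Lemma proj_onto m n a : m <= n -> floor (@height m) a ->
  exists2 b, floor (@height n) b & proj m b = a.
Proof.
move=> mn fa; have [w aw] := mem_sub_ex a.1 mn.
have : a \in floors (@height m) (sub m w) by rewrite mem_floors aw.
move=> /(nthP (origin m))[j]; rewrite (height_compat_sub mn) => jw E.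
by exists (w, j).
Qed.

End Substitutions.

(** A cluster point of a sequence whose nth term is chosen in [C n] lies in every [C n], as the
    terms from n on belong to this closed set. *)
Lemma compact_nested (T : topologicalType) (C : nat -> set T) :
  compact [set: T] -> (forall n, closed (C n)) -> (forall n, C n !=set0) ->
  (forall n, C n.+1 `<=` C n) -> exists z, forall n, C n z.
Proof.
move=> cT Ccl C0 CS; have [s sC] := choice C0.
have Cle m n : m <= n -> C n `<=` C m.
  elim: n => [|n IH]; first by rewrite leqn0 => /eqP ->.
  rewrite leq_eqVlt => /predU1P[-> //|mn]; exact: subset_trans (CS n) (IH mn).
have [z [_ zs]] : [set: T] `&` cluster (s @ \oo) !=set0 by apply: cT; exact: filterT.
exists z => n; apply: (Ccl n) => A zA.
have ns : (s @ \oo) (s @` [set k | n <= k]) by exists n => // k /= nk; exists k.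
have [y [[k /= nk <-] Ask]] := zs _ _ ns zA.
by exists (s k); split=> //; exact: Cle nk _ (sC k).
Qed.

Definition coherent (B : obd) (x : forall n, V B n * nat) : Prop :=
  (forall n, floor (@height B n) (x n)) /\
  (forall m n, m <= n -> x m = proj m (x n)).

Lemma coherent_succ (B : obd) (x : forall n, V B n * nat) :
  (forall n, floor (@height B n) (x n)) ->
  (forall n, x n = proj n (x n.+1)) -> coherent x.
Proof.
move=> fx xS; split=> // m n; elim: n => [|n IH].
  by rewrite leqn0 => /eqP ->; rewrite proj_id.
rewrite leq_eqVlt => /predU1P[->|mn]; first by rewrite proj_id.
by rewrite IH // (xS n) proj_comp.
Qed.

(* The path space of [B]: an infinite path is recorded by the positions
   [x n] of its initial segments among all paths ending at the same vertex of
   level [n]. The parameter [R] only fixes the values of the metric. *)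
Record tower_limit (R : realType) (B : obd) := TowerLimit {
  address :> forall n, V B n * nat;
  address_coherent : coherent address }.

HB.instance Definition _ R B := gen_eqMixin (tower_limit R B).
HB.instance Definition _ R B := gen_choiceMixin (tower_limit R B).

Section TowerLimit.
Variables (R : realType) (B : obd).
Local Notation X := (tower_limit R B).
Implicit Types x y z : X.

Lemma address_floor x n : floor (@height B n) (x n).
Proof. by have [] := address_coherent x. Qed.

Lemma address_proj x m n : m <= n -> x m = proj m (x n).
Proof. by have [_] := address_coherent x; apply. Qed.

Lemma address_le x y m n : m <= n -> x n = y n -> x m = y m.
Proof. by move=> mn xy; rewrite (address_proj x mn) xy -address_proj. Qed.

Lemma limit_ext x y : (forall n, x n = y n) -> x = y.
Proof.
case: x y => [x xP] [y yP] /= xy; have E : x = y by apply: functional_extensionality_dep.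
by subst y; congr TowerLimit; exact: Prop_irrelevance.
Qed.

Lemma limit_ext_large N x y : (forall n, N <= n -> x n = y n) -> x = y.
Proof.
move=> xy; apply: limit_ext => n; apply: (address_le (leq_maxl n N)).
exact/xy/leq_maxr.
Qed.

(** Coherence from level N on is enough; the lower levels are filled in by projection. *)
Lemma limit_ex N (s : forall n, V B n * nat) :
  (forall n, N <= n -> floor (@height B n) (s n)) ->
  (forall m n, N <= m -> m <= n -> s m = proj m (s n)) ->
  exists x, forall n, N <= n -> x n = s n.
Proof.
move=> fs ss; pose a n := proj n (s (maxn n N)).
have aP : coherent a.
  split=> [n|m n mn]; first exact/proj_floor/fs/leq_maxr/leq_maxl.
  rewrite /a proj_comp ?leq_maxl //; last exact/fs/leq_maxr.
  rewrite (ss (maxn m N) (maxn n N)) ?leq_maxr //; last first.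
    by rewrite geq_max leq_maxr leq_max mn.
  rewrite proj_comp ?leq_maxl //; last exact/fs/leq_maxr.
  by rewrite geq_max leq_maxr leq_max mn.
exists (TowerLimit R aP) => n Nn; rewrite /= /a (maxn_idPl Nn).
exact/proj_id/fs.
Qed.

(** Up to level n the addresses are projections of [a]; above it, preimages under projection are
    chosen one level at a time. *)
Lemma address_onto n a : floor (@height B n) a -> exists x, x n = a.
Proof.
move=> fa.
have nx_ex k (b : V B k * nat) : exists c : V B k.+1 * nat, floor (@height B k) b ->
    floor (@height B k.+1) c /\ proj k c = b.
  case: (boolP (floor (@height B k) b)) => [fb|_]; last by exists (origin B k.+1).
  by have [c ? ?] := proj_onto (leqnSn k) fb; exists c.
have nx_ex' k := choice (nx_ex k).
pose nx k := projT1 (nx_ex' k).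
have nxP k b : floor (@height B k) b ->
    floor (@height B k.+1) (nx k b) /\ proj k (nx k b) = b.
  exact: (projT2 (nx_ex' k) b).
pose s := fix s k : V B k * nat := match k with
  | 0 => proj 0 a
  | k'.+1 => if k'.+1 <= n then proj k'.+1 a else nx k' (s k') end.
have sn k : k <= n -> s k = proj k a by case: k => //= k ->.
have sf k : floor (@height B k) (s k).
  elim: k => [|k IH] /=; first exact: proj_floor.
  by case: ifP => kn; [exact: proj_floor | have [] := nxP k _ IH].
have ss k : s k = proj k (s k.+1).
  rewrite /=; case: ifP => kn; last by have [_ ->] := nxP k _ (sf k).
  by rewrite proj_comp // sn // ltnW.
have cs := coherent_succ sf ss.
by exists (TowerLimit R cs); rewrite /= sn // proj_id.
Qed.

Lemma limit_neq x y : x != y -> exists n, x n != y n.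
Proof.
move=> xy; apply/not_existsP => H; move/eqP: xy; apply; apply: limit_ext => n.
by apply/eqP; apply: contrapT => /negP; exact: H.
Qed.

Definition first_diff x y : nat :=
  if pselect (exists n, x n != y n) is left e then ex_minn e else 0.

(** Normalised so that the open ball of radius 1/(n+1) is exactly a cylinder of level n, see
    [limit_dist_lt]. *)
Definition limit_dist x y : R :=
  if x == y then 0%R else ((first_diff x y).+1%:R^-1)%R.

Lemma first_diffP x y n : x != y -> (n < first_diff x y) = (x n == y n).
Proof.
move=> /limit_neq ex; rewrite /first_diff; case: pselect => // e.
case: ex_minnP => k xyk kmin; apply/idP/idP => [nk|/eqP xyn].
  by apply: contraLR nk => /kmin; rewrite -leqNgt.
by rewrite ltnNge; apply: contraNN xyk => kn; apply/eqP/(address_le kn).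
Qed.

Lemma limit_dist_lt x y n : (limit_dist x y < n.+1%:R^-1)%R = (x n == y n).
Proof.
rewrite /limit_dist; case: (eqVneq x y) => [->|xy].
  by rewrite eqxx invr_gt0 ltr0n.
by rewrite ltf_pV2 ?posrE ?ltr0n // ltr_nat ltnS first_diffP.
Qed.

Lemma limit_dist_ge0 x y : (0 <= limit_dist x y)%R.
Proof. by rewrite /limit_dist; case: ifP => // _; rewrite invr_ge0 ler0n. Qed.

Lemma limit_distxx x : limit_dist x x = 0%R.
Proof. by rewrite /limit_dist eqxx. Qed.

Lemma limit_dist_eq0 x y : limit_dist x y = 0%R -> x = y.
Proof.
rewrite /limit_dist; case: eqP => // _ /eqP.
by rewrite invr_eq0 pnatr_eq0.
Qed.

Lemma limit_dist_sym x y : limit_dist x y = limit_dist y x.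
Proof.
have le u v : u != v -> first_diff u v <= first_diff v u.
  move=> uv; rewrite leqNgt first_diffP //; have vu : v != u by rewrite eq_sym.
  by have := ltnn (first_diff v u); rewrite first_diffP // eq_sym => ->.
rewrite /limit_dist; case: (eqVneq x y) => // xy; have yx : y != x by rewrite eq_sym.
by congr (_.+1%:R^-1)%R; apply/eqP; rewrite eqn_leq !le.
Qed.

(** At the first level where x and z differ, y differs from one of them, and that distance alone is
    at least the left-hand side. *)
Lemma limit_dist_triangle y x z :
  (limit_dist x z <= limit_dist x y + limit_dist y z)%R.
Proof.
case: (eqVneq x z) => [->|xz].
  by rewrite limit_distxx addr_ge0 ?limit_dist_ge0.
rewrite {1}/limit_dist (negbTE xz); set N := first_diff x z.
have : x N != z N by rewrite -first_diffP // ltnn.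
case: (eqVneq (x N) (y N)) => [->|xy _].
  rewrite -limit_dist_lt -leNgt => /le_trans; apply.
  by rewrite lerDr limit_dist_ge0.
move: xy; rewrite -limit_dist_lt -leNgt => /le_trans; apply.
by rewrite lerDl limit_dist_ge0.
Qed.

HB.instance Definition _ := isMetric.Build R X limit_distxx limit_dist_eq0
  limit_dist_sym limit_dist_triangle.

Lemma limit_nbhsP x (A : set X) :
  nbhs x A <-> exists n, forall y, y n = x n -> A y.
Proof.
have bE (e : R) y : ball x e y = (limit_dist x y < e)%R.
  by rewrite ballEmdist.
split=> [/nbhs_ballP[e /= e0 eA]|[n nA]].
  exists (Num.bound e^-1) => y yx; apply: eA; rewrite bE.
  apply: (@lt_trans _ _ ((Num.bound e^-1).+1%:R^-1)%R).
    by rewrite limit_dist_lt yx.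
  rewrite invf_plt ?posrE ?ltr0n //.
  apply: (@lt_le_trans _ _ (Num.bound e^-1)%:R%R); last by rewrite ler_nat.
  by apply: archi_boundP; rewrite invr_ge0 ltW.
apply/nbhs_ballP; exists (n.+1%:R^-1)%R; first by rewrite /= invr_gt0 ltr0n.
by move=> y; rewrite bE limit_dist_lt => /eqP/esym; exact: nA.
Qed.

Lemma cylinder_clopen n (P : set (V B n * nat)) : clopen [set x : X | P (x n)].
Proof.
have o (Q : set (V B n * nat)) : open [set x : X | Q (x n)].
  by rewrite openE => x /= Qx; apply/limit_nbhsP; exists n => y /= ->.
by split=> //; rewrite -openC; exact: (o (~` P)).
Qed.

Lemma limit_hausdorff : hausdorff_space X.
Proof. exact: metric_hausdorff. Qed.

Lemma limit_zero_dimensional : zero_dimensional X.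
Proof.
move=> x y /limit_neq[n xy]; exists [set z : X | z n = x n]; split=> //.
  exact: (@cylinder_clopen n (fun a => a = x n)).
by move=> /esym/eqP; exact/negP.
Qed.

(** Level n has finitely many floors, and an ultrafilter containing a finite union contains one of
    its pieces. *)
Lemma ultra_address (F : set_system X) n : UltraFilter F ->
  exists a, F [set x | x n = a].
Proof.
move=> FU; pose s := floors (@height B n) (enum (V B n)).
have : F [set x | x n \in s].
  apply: filterS filterT => x _ /=.
  by rewrite mem_floors mem_enum address_floor.
elim: s => [|a s IH] Fs.
  suff : F set0 by move/filter_not_empty.
  by apply: filterS Fs => x /=.
have [Fa|FNa] := in_ultra_setVsetC [set x : X | x n = a] FU; first by exists a.
apply: IH; apply: filterS (filterI Fs FNa) => x /= [].
by rewrite inE => /predU1P[].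
Qed.

(** The addresses selected by the ultrafilter are coherent because any two of the selected cylinders
    meet; the point they define is a limit. *)
Lemma limit_compact : compact [set: X].
Proof.
rewrite compact_ultra => F FU _.
pose a n := projT1 (cid (ultra_address n FU)).
have aP n : F [set x | x n = a n] := projT2 (cid (ultra_address n FU)).
have [x xa] : exists x : X, forall n, 0 <= n -> x n = a n.
  apply: limit_ex => [n _|m n _ mn].
    by have [x <-] := filter_ex (aP n); exact: address_floor.
  have [x [<- <-]] := filter_ex (filterI (aP m) (aP n)).
  exact: address_proj.
exists x; split=> // A /limit_nbhsP[n nA].
by apply: filterS (aP n) => y /= ya; apply: nA; rewrite ya xa.
Qed.

(** Compactness in the form of König's lemma, used below to extract uniform levels. *)
Lemma limit_koenig (P : forall n, V B n * nat -> Prop) :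
  (forall n, exists x : X, P n (x n)) ->
  (forall (x : X) m n, m <= n -> P n (x n) -> P m (x m)) ->
  exists x : X, forall n, P n (x n).
Proof.
move=> exP Pm; apply: (@compact_nested X (fun n => [set x | P n (x n)])).
- exact: limit_compact.
- by move=> n; have [] := cylinder_clopen (P n).
- exact: exP.
- by move=> n x; apply: Pm.
Qed.

End TowerLimit.

Lemma origin_floor (B : obd) n : floor (@height B n) (origin B n).
Proof. exact: height_gt0. Qed.

Definition default_point (R : realType) (B : obd) : tower_limit R B :=
  projT1 (cid (address_onto R (origin_floor B 0))).

HB.instance Definition _ R B :=
  isPointed.Build (tower_limit R B) (default_point R B).

(** * The Vershik map *)

Lemma compact_inverse_continuous (X Y : topologicalType) (f : X -> Y) (g : Y -> X) :
  compact [set: X] -> hausdorff_space Y -> continuous f -> cancel f g ->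
  cancel g f -> continuous g.
Proof.
move=> cX hY cf fK gK; apply/continuous_closedP => A cA.
have -> : g @^-1` A = f @` A.
  by apply/seteqP; split=> [y Ay|_ [x Ax <-]] /=; [exists (g y) | rewrite fK].
apply: compact_closed => //; apply: continuous_compact.
  exact: continuous_subspaceT.
exact: subclosed_compact cA cX _.
Qed.

Section Vershik.
Variables (R : realType) (B : obd).
Local Notation X := (tower_limit R B).
Local Notation lstep n := (step (@height B n)).
Local Notation ltop n := (top (@height B n)).
Implicit Types x y z : X.

Lemma limit_continuous (Y : topologicalType) (f : Y -> X) :
  (forall n u, nbhs u [set v | f v n = f u n]) -> continuous f.
Proof.
move=> H u A /limit_nbhsP[n nA]; apply: filterS (H n u) => v /= vu.
exact: nA.
Qed.

(** Proper ordering in terms of addresses; [properly_orderedP] identifies the two. *)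
Definition unique_ends : Prop :=
  (exists! x, forall n, ltop n (x n)) /\ (exists! x, forall n, bottom (x n)).

Definition stepx x y : Prop := forall n, lstep n (x n) (y n).

Lemma top_le x m n : m <= n -> ltop n (x n) -> ltop m (x m).
Proof. by move=> mn; rewrite (address_proj x mn); exact: proj_top. Qed.

Lemma bottom_le x m n : m <= n -> bottom (x n) -> bottom (x m).
Proof.
by move=> mn; rewrite (address_proj x mn); apply: proj_bottom => //; exact: address_floor.
Qed.

Lemma step_le x y m n : m <= n -> lstep n (x n) (y n) -> lstep m (x m) (y m).
Proof.
move=> mn; rewrite (address_proj x mn) (address_proj y mn).
by apply: proj_step => //; exact: address_floor.
Qed.

Lemma stepx_large N x y : (forall n, N <= n -> lstep n (x n) (y n)) -> stepx x y.
Proof. by move=> H n; apply: (step_le (leq_maxl n N)); exact/H/leq_maxr. Qed.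

Lemma stepx_bottom x y n : stepx x y -> bottom (y n) = ltop n (x n).
Proof. by move=> xy; apply: step_bottom (xy n); exact: address_floor. Qed.

(** Applied to tops and bottoms: a point is extreme at all levels or, from some level on, has a
    neighbouring floor in its own tower. *)
Lemma not_all_large (E : forall n, pred (V B n * nat)) x :
  (forall m n, m <= n -> E n (x n) -> E m (x m)) ->
  (forall n, E n (x n)) \/ exists N, forall n, N <= n -> ~~ E n (x n).
Proof.
move=> Ele; have [|/existsNP[N /negP EN]] := pselect (forall n, E n (x n)).
  by left.
by right; exists N => n Nn; apply: contra EN; exact: Ele.
Qed.

(** Otherwise each level k carries a point satisfying [E k] with the wrong address at level n; a
    limit of such points would satisfy E everywhere, hence equal [x0]. *)
Lemma end_close (E : forall n, pred (V B n * nat)) x0 n :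
  (forall x m n, m <= n -> E n (x n) -> E m (x m)) ->
  (forall x, (forall n, E n (x n)) -> x = x0) ->
  exists k, forall x, E k (x k) -> x n = x0 n.
Proof.
move=> Ele Euniq; apply: contrapT => /forallNP H.
pose P k a := exists z, [/\ z k = a, E k a & z n <> x0 n].
have [z zP] : exists z : X, forall k, P k (z k).
  apply: limit_koenig => [k|z j k jk [y [yk Ek yn]]].
    have /existsNP[z /not_implyP[Ez zn]] := H k.
    by exists z, z.
  by exists y; split=> //; [exact: address_le yk | exact: Ele Ek].
have zx : z = x0 by apply: Euniq => k; have [y []] := zP k.
by have [y [yn _]] := zP n; rewrite yn zx.
Qed.

Hypothesis ends : unique_ends.

Definition max_point : X := projT1 (cid ends.1).
Definition min_point : X := projT1 (cid ends.2).

Lemma max_pointP n : ltop n (max_point n).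
Proof. by rewrite /max_point; case: cid => x /= []. Qed.

Lemma min_pointP n : bottom (min_point n).
Proof. by rewrite /min_point; case: cid => x /= []. Qed.

Lemma max_point_uniq x : (forall n, ltop n (x n)) -> x = max_point.
Proof. by rewrite /max_point; case: cid => y /= [_ yu] /yu. Qed.

Lemma min_point_uniq x : (forall n, bottom (x n)) -> x = min_point.
Proof. by rewrite /min_point; case: cid => y /= [_ yu] /yu. Qed.

Lemma next_ex x : exists y, stepx x y.
Proof.
have [xt|[N xN]] := not_all_large (E := fun n => ltop n) (top_le (x := x)).
  (* The maximal point is sent to the minimal one. *)
  by exists min_point => n; rewrite step_top // min_pointP.
pose s n : V B n * nat := ((x n).1, (x n).2.+1).
have fs n : N <= n -> floor (@height B n) (s n).
  by move=> /xN; rewrite /floor /= -floor_topN //; exact: address_floor.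
have ss n : N <= n -> lstep n (x n) (s n).
  by move=> Nn; rewrite stepN ?xN // address_floor.
have [|y ys] := limit_ex R fs.
  (* Coherence: a step projects to a step, and below the top its target is forced. *)
  move=> m n Nm mn; have Nn := leq_trans Nm mn.
  have := proj_step mn (address_floor x n) (fs n Nn) (ss n Nn).
  by rewrite -(address_proj x mn) stepN ?xN ?address_floor // => /eqP.
by exists y; apply: (@stepx_large N) => n Nn; rewrite ys // ss.
Qed.

Lemma next_uniq x y z : stepx x y -> stepx x z -> y = z.
Proof.
move=> xy xz; have [xt|[N xN]] := not_all_large (E := fun n => ltop n) (top_le (x := x)).
  have E u : stepx x u -> u = min_point.
    by move=> xu; apply: min_point_uniq => n; rewrite (stepx_bottom n xu).
  by rewrite (E y xy) (E z xz).
apply: (@limit_ext_large _ _ N) => n /xN xn.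
move: (xy n) (xz n); rewrite !stepN ?address_floor //.
by move=> /eqP -> /eqP ->.
Qed.

Lemma prev_ex y : exists x, stepx x y.
Proof.
have [yb|[N yN]] := not_all_large (E := fun n => @bottom _) (bottom_le (x := y)).
  by exists max_point => n; rewrite step_top ?max_pointP.
pose s n : V B n * nat := ((y n).1, (y n).2.-1).
have s1 n : N <= n -> (s n).2.+1 = (y n).2.
  by move=> /yN; rewrite /bottom -lt0n => /prednK.
have fs n : N <= n -> floor (@height B n) (s n).
  move=> Nn; have := address_floor y n; rewrite /floor -s1 //.
  exact: leq_trans (leqnSn _).
have ss n : N <= n -> lstep n (s n) (y n).
  move=> Nn; have := address_floor y n; rewrite /floor /step s1 //= => ->.
  exact/eqP/surjective_pairing.
have [|x xs] := limit_ex R fs.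
  move=> m n Nm mn; have Nn := leq_trans Nm mn.
  have fp := proj_floor mn (fs n Nn).
  have := proj_step mn (fs n Nn) (address_floor y n) (ss n Nn).
  rewrite -(address_proj y mn) => sy; have := yN m Nm.
  rewrite (step_bottom fp sy) => nt; move: sy; rewrite stepN // => /eqP E.
  by rewrite /s E /=; case: (proj _ _).
by exists x; apply: (@stepx_large N) => n Nn; rewrite xs // ss.
Qed.

Lemma prev_uniq x y z : stepx x z -> stepx y z -> x = y.
Proof.
move=> xz yz; have [zb|[N zN]] := not_all_large (E := fun n => @bottom _) (bottom_le (x := z)).
  have E u : stepx u z -> u = max_point.
    by move=> uz; apply: max_point_uniq => n; rewrite -(stepx_bottom n uz).
  by rewrite (E x xz) (E y yz).
apply: (@limit_ext_large _ _ N) => n /zN zn.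
have xn := zn; have yn := zn.
rewrite (stepx_bottom _ xz) in xn; rewrite (stepx_bottom _ yz) in yn.
move: (xz n) (yz n); rewrite !stepN ?address_floor //.
by case: (x n) (y n) => [v i] [w j] /= /eqP -> /eqP[-> ->].
Qed.

Definition vershik x : X := projT1 (cid (next_ex x)).
Definition vershik_inv y : X := projT1 (cid (prev_ex y)).

Lemma vershikP x : stepx x (vershik x).
Proof. exact: projT2 (cid (next_ex x)). Qed.

Lemma vershik_invP y : stepx (vershik_inv y) y.
Proof. exact: projT2 (cid (prev_ex y)). Qed.

Lemma vershikE x y : stepx x y -> vershik x = y.
Proof. exact/next_uniq/vershikP. Qed.

Lemma vershikK : cancel vershik vershik_inv.
Proof. by move=> x; apply: prev_uniq (vershik_invP _) (vershikP x). Qed.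

Lemma vershik_invK : cancel vershik_inv vershik.
Proof. by move=> x; exact/vershikE/vershik_invP. Qed.

(** Away from the maximal point the image address is read off from one sufficiently high address. A
    point near the maximal point is on a top floor of a high level, so its image is on a bottom
    floor there, hence near the minimal point by [end_close]. *)
Lemma vershik_continuous : continuous vershik.
Proof.
apply: limit_continuous => n x; apply/limit_nbhsP.
have [xt|[N xN]] := not_all_large (E := fun n => ltop n) (top_le (x := x)).
  have [k kP] := end_close n (E := fun n => @bottom _) bottom_le min_point_uniq.
  exists k => y yx /=; rewrite !kP //; first by rewrite (stepx_bottom k (vershikP x)).
  by rewrite (stepx_bottom k (vershikP y)) yx.
exists (maxn n N) => y yx /=; apply: (address_le (leq_maxl n N)).
have xn := xN _ (leq_maxr n N).
move: (vershikP x (maxn n N)) (vershikP y (maxn n N)).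
by rewrite yx !stepN ?address_floor // => /eqP -> /eqP ->.
Qed.

Lemma vershik_inv_continuous : continuous vershik_inv.
Proof.
apply: compact_inverse_continuous vershik_continuous vershikK vershik_invK.
- exact: limit_compact.
- exact: limit_hausdorff.
Qed.

Lemma vershik_homeo : homeomorphism vershik.
Proof.
split; first exact: vershik_continuous.
exists vershik_inv; split.
- exact: vershik_inv_continuous.
- exact: vershikK.
- exact: vershik_invK.
Qed.

Lemma vershik_bottom x n : bottom (vershik x n) = ltop n (x n).
Proof. exact/stepx_bottom/vershikP. Qed.

Lemma vershik_up x n v j : j.+1 < height v ->
  (x n == (v, j)) = (vershik x n == (v, j.+1)).
Proof.
move=> jv; have := vershikP x n; case: (boolP (ltop n (x n))) => [xt|xt].
  rewrite step_top // => bx; apply/eqP/eqP => E.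
    by move: xt; rewrite E /top /= ltn_eqF.
  by move: bx; rewrite E.
rewrite stepN ?address_floor // => /eqP ->; case: (x n) => w i.
by rewrite !xpair_eqE eqSS.
Qed.

End Vershik.

(** * Paths and addresses *)

(** Positivity matters: empty blocks after block r would spoil the equivalence. *)
Lemma flatten_index_last (s : seq nat) r j : all (leq 1) s -> r < size s ->
  j < nth 0 s r ->
  ((flatten_index s r j).+1 == sumn s) = (r.+1 == size s) && (j.+1 == nth 0 s r).
Proof.
move=> s_gt0 rs js; rewrite /flatten_index -{2}(cat_take_drop r s) sumn_cat.
rewrite (drop_nth 0) //= -addnS eqn_add2l.
have [rS|rS] := eqVneq r.+1 (size s).
  by rewrite rS drop_size addn0.
have : drop r.+1 s != [::].
  by rewrite -size_eq0 size_drop subn_eq0 -ltnNge ltn_neqAle rS.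
have : all (leq 1) (drop r.+1 s) by apply/allP => x /mem_drop; exact/allP.
case: (drop _ _) => //= k t /andP[k0 _] _; apply/negbTE; rewrite neq_ltn.
by rewrite (leq_ltn_trans js) // -addn1 leq_add2l addn_gt0 k0.
Qed.

Lemma flatten_index_first (s : seq nat) r j : all (leq 1) s -> r < size s ->
  (flatten_index s r j == 0) = (r == 0) && (j == 0).
Proof.
rewrite /flatten_index addn_eq0; case: r => [|r]; first by rewrite take0.
by case: s => //= k s /andP[k0 _] _; rewrite addn_eq0 -leqn0 leqNgt k0.
Qed.

Section EdgeRank.
Variables (S T : finType) (F : edge_set S T).
Implicit Types e : F.

Definition rank e : nat := index e (fibre F (rng F e)).

Lemma rank_lt e : rank e < size (word F (rng F e)).
Proof. by rewrite index_fibre. Qed.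

Lemma rank_inj e e' : rng F e = rng F e' -> rank e = rank e' -> e = e'.
Proof.
move=> r; rewrite /rank r => /(congr1 (nth e (fibre F (rng F e')))).
by rewrite !nth_index // mem_fibre ?r.
Qed.

Lemma ele_rank e e' : rng F e = rng F e' -> ele F e e' = (rank e <= rank e').
Proof. by move=> r; rewrite (ele_index r erefl) /rank r. Qed.

Lemma ele_rng e e' : ele F e e' -> rng F e = rng F e'.
Proof. by move=> ee'; apply/eqP; rewrite -ele_comparable ee'. Qed.

Lemma rank_ex w i : i < size (word F w) -> exists2 e, rng F e = w & rank e = i.
Proof. by move=> /fibre_of_index[e ew ei]; exists e; rewrite // /rank ew. Qed.

Lemma max_edgeP e : max_edge e <-> (rank e).+1 = size (word F (rng F e)).
Proof.
split=> [emax|er e' ee'].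
  apply/eqP; rewrite eqn_leq rank_lt leqNgt; apply/negP => /rank_ex[e' ew ei].
  have /emax E : ele F e e' by rewrite ele_rank // ei.
  by move: ei; rewrite E => /eqP; rewrite ltn_eqF.
have r := ele_rng ee'; apply: rank_inj => //; apply/eqP.
by rewrite eqn_leq -(ele_rank r) ee' andbT -ltnS er r rank_lt.
Qed.

Lemma min_edgeP e : min_edge e <-> rank e = 0.
Proof.
split=> [emin|e0 e' e'e]; last first.
  have r := ele_rng e'e; apply: rank_inj => //.
  by move: e'e; rewrite ele_rank // e0 leqn0 => /eqP ->.
have [e' ew ei] := rank_ex (leq_trans (ltn0Sn _) (rank_lt e)).
by rewrite -ei (emin e') // ele_rank // ei.
Qed.

End EdgeRank.

Section PathCoding.
Variables (R : realType) (B : obd).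
Local Notation X := (tower_limit R B).
Implicit Types (x y : forall n, E B n) (a b : X).

Let heights n (e : E B n) : seq nat :=
  map (@height B n) (word (E B n) (rng (E B n) e)).

(** In the reverse lexicographic order the paths with last edge [x n] form one block, after the
    blocks of the smaller edges; [flatten_index] turns a position in that block into a position
    among all paths to the vertex. *)
Definition coded_by x a : Prop := forall n,
  [/\ (a n).1 = src _ (x n), (a n.+1).1 = rng _ (x n) &
      (a n.+1).2 = flatten_index (heights (x n)) (rank (x n)) (a n).2].

Let heights_gt0 n (e : E B n) : all (leq 1) (heights e).
Proof. by apply/allP => _ /mapP[v _ ->]; exact: height_gt0. Qed.

Let size_heights n (e : E B n) : size (heights e) = size (word (E B n) (rng _ e)).
Proof. exact: size_map. Qed.

Let sumn_heights n (e : E B n) : sumn (heights e) = height (rng _ e).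
Proof.
rewrite -(height_compat_sub (leqnSn n)) size_floors.
by rewrite (sub_edge (rng (E B n) e)).
Qed.

Let nth_heights n (e : E B n) : nth 0 (heights e) (rank e) = height (src _ e).
Proof.
rewrite (nth_map (src _ e)) ?rank_lt //.
by rewrite (nth_word _ erefl).
Qed.

Let proj_coded n (e : E B n) v i : rng _ e = v -> i < height (src _ e) ->
  proj n (v, flatten_index (heights e) (rank e) i) = (src _ e, i).
Proof.
move=> <- iv; rewrite /proj /subst_floor /= sub_edge /floors nth_flatten.
have -> : shape (map (tower (@height B n)) (word (E B n) (rng _ e))) = heights e.
  rewrite /shape -map_comp; apply: eq_map => w /=.
  by rewrite size_map size_iota.
rewrite flatten_indexKl ?flatten_indexKr ?nth_heights //.
rewrite (nth_map (src _ e)) ?rank_lt // (nth_word _ erefl).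
by rewrite (nth_map 0) ?size_iota // nth_iota.
Qed.

Lemma path_coded x : path_space B x -> exists a, coded_by x a.
Proof.
move=> px; pose pos := fix pos n := match n with
  | 0 => 0
  | n'.+1 => flatten_index (heights (x n')) (rank (x n')) (pos n') end.
pose a n := (src _ (x n), pos n).
have fa n : floor (@height B n) (a n).
  rewrite /floor /=; elim: n => [|n IH]; first exact: height_gt0.
  by rewrite /= -px -sumn_heights; apply: flatten_indexP; rewrite nth_heights.
have ca : coherent a.
  apply: coherent_succ => // n; rewrite {2}/a /= -px proj_coded //.
  exact: fa.
by exists (TowerLimit R ca) => n; split=> //=; rewrite px.
Qed.

Lemma coded_path_ex a : exists x, path_space B x /\ coded_by x a.
Proof.
have ex n : exists e : E B n, [/\ (a n).1 = src _ e, (a n.+1).1 = rng _ e &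
    (a n.+1).2 = flatten_index (heights e) (rank e) (a n).2].
  case Ea : (a n.+1) => [v j]; have := address_floor a n.+1; rewrite Ea /floor /=.
  pose hs := map (@height B n) (word (E B n) v).
  have -> : height v = sumn hs.
    by rewrite -(height_compat_sub (leqnSn n)) size_floors (sub_edge v).
  (* The block containing position j gives the last edge, and the offset in it the position one
     level down. *)
  move=> jv; have := reshape_indexP jv; rewrite size_map => /rank_ex[e ev er].
  exists e; have hE : heights e = hs by rewrite /heights ev.
  have jE : flatten_index (heights e) (rank e) (reshape_offset hs j) = j.
    by rewrite hE er reshape_indexK.
  have off : reshape_offset hs j < height (src _ e).
    by rewrite -nth_heights hE er reshape_offsetP.
  have -> : a n = (src _ e, reshape_offset hs j).
    by rewrite (address_proj a (leqnSn n)) Ea -{1}jE proj_coded.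
  by split; rewrite // jE.
pose x n := projT1 (cid (ex n)).
have cx : coded_by x a by move=> n; exact: projT2 (cid (ex n)).
exists x; split=> // n; have [_ <- _] := cx n; have [-> _ _] := cx n.+1.
by [].
Qed.

Lemma coded_by_point x a b : coded_by x a -> coded_by x b -> a = b.
Proof.
move=> xa xb; apply: limit_ext; elim=> [|n IH].
  exact: floor_root (address_floor a 0) (address_floor b 0).
have [_ a1 a2] := xa n; have [_ b1 b2] := xb n.
by rewrite (surjective_pairing (a n.+1)) (surjective_pairing (b n.+1)) a1 a2 b1 b2 IH.
Qed.

Lemma coded_by_path x y a : coded_by x a -> coded_by y a -> x = y.
Proof.
move=> xa ya; apply: functional_extensionality_dep => n.
have [xs xr xj] := xa n; have [ys yr yj] := ya n.
have r : rng _ (x n) = rng _ (y n) by rewrite -xr yr.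
have af := address_floor a n.
apply: rank_inj => //.
rewrite -(flatten_indexKl (sh := heights (x n)) (r := rank (x n)) (c := (a n).2)).
  rewrite -xj yj /heights r -/(heights (y n)) flatten_indexKl // nth_heights -ys.
  exact: af.
by rewrite nth_heights -xs; exact: af.
Qed.

Lemma coded_by_top x a n : coded_by x a ->
  top (@height B n.+1) (a n.+1) <-> top (@height B n) (a n) /\ max_edge (x n).
Proof.
move=> /(_ n)[a1 a2 a3]; have af := address_floor a n.
rewrite /top a2 a3 -sumn_heights flatten_index_last //.
- rewrite nth_heights size_heights -a1 andbC max_edgeP; split.
    by move=> /andP[-> /eqP ->].
  by move=> [-> ->]; rewrite eqxx.
- by rewrite size_heights rank_lt.
- by rewrite nth_heights -a1; exact: af.
Qed.

Lemma coded_by_bottom x a n : coded_by x a ->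
  bottom (a n.+1) <-> bottom (a n) /\ min_edge (x n).
Proof.
move=> /(_ n)[a1 a2 a3]; rewrite /bottom a3 flatten_index_first //.
  by rewrite andbC min_edgeP; split=> [/andP[-> /eqP ->]|[-> ->]].
by rewrite size_heights rank_lt.
Qed.

Lemma coded_by_max x a : coded_by x a ->
  (forall n, top (@height B n) (a n)) <-> (forall n, max_edge (x n)).
Proof.
move=> xa; split=> [t n|m]; first by have /(coded_by_top n xa)[] := t n.+1.
elim=> [|n IH]; last by apply/(coded_by_top n xa).
by have := address_floor a 0; rewrite /floor /top height0 ltnS leqn0 => /eqP ->.
Qed.

Lemma coded_by_min x a : coded_by x a ->
  (forall n, bottom (a n)) <-> (forall n, min_edge (x n)).
Proof.
move=> xa; split=> [t n|m]; first by have /(coded_by_bottom n xa)[] := t n.+1.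
elim=> [|n IH]; last by apply/(coded_by_bottom n xa).
by have := address_floor a 0; rewrite /floor /bottom height0 ltnS leqn0.
Qed.

Lemma properly_orderedP : properly_ordered B <-> unique_ends R B.
Proof.
(* Unique existence is transported along the bijection between paths and addresses. *)
have tr (P : X -> Prop) (Q : (forall n, E B n) -> Prop) :
    (forall x a, coded_by x a -> P a <-> Q x) ->
    (exists! x, path_space B x /\ Q x) <-> (exists! a, P a).
  move=> PQ; split=> [[x [[px Qx] xu]]|[a [Pa au]]].
    have [a xa] := path_coded px; exists a; split; first exact/(PQ _ _ xa).
    move=> b Pb; have [y [py yb]] := coded_path_ex b.
    have E : x = y by apply: xu; split=> //; exact/(PQ _ _ yb).
    by apply: (@coded_by_point x) => //; rewrite E.
  have [x [px xa]] := coded_path_ex a; exists x; split.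
    by split=> //; exact/(PQ _ _ xa).
  move=> y [py Qy]; have [b yb] := path_coded py.
  have E : a = b by apply: au; exact/(PQ _ _ yb).
  by apply: (@coded_by_path _ _ a) => //; rewrite E.
rewrite /properly_ordered /unique_ends.
by rewrite (tr _ _ coded_by_max) (tr _ _ coded_by_min).
Qed.

Lemma infinite_path_space :
  infinite_set (path_space B) <-> infinite_set [set: X].
Proof.
have [g gP] := choice coded_path_ex.
have gE : path_space B = g @` [set: X].
  apply/seteqP; split=> [x px|_ [a _ <-]]; last by have [] := gP a.
  have [a xa] := path_coded px; exists a => //; have [_ ga] := gP a.
  exact: coded_by_path ga xa.
have gI : injective g.
  move=> a b ab; have [_ ga] := gP a; have [_ gb] := gP b.
  by apply: coded_by_point ga _; rewrite ab.
rewrite gE; split=> inf fin; apply: inf; first exact: finite_image.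
have -> : [set: X] = g @^-1` (g @` [set: X]) by apply/seteqP; split=> a // _; exists a.
by apply: finite_preimage => // a b _ _; exact: gI.
Qed.

End PathCoding.

(** * The dynamical system of a diagram *)

Section TowerSystem.
Variables (R : realType) (B : obd).
Hypothesis ends : unique_ends R B.
Local Notation X := (tower_limit R B).
Local Notation phi := (vershik ends).
Local Notation psi := (vershik_inv ends).
Implicit Types x y z : X.

Definition tower_num (n : nat) : nat := #|V B n|.

Definition tower_height n (k : 'I_(tower_num n)) : nat := height (enum_val k).

Definition tower_set n (k : 'I_(tower_num n)) (j : nat) : set X :=
  [set x | x n = (enum_val k, j)].

Lemma tower_setP n x : exists2 k : 'I_(tower_num n),
  enum_val k = (x n).1 & (x n).2 < tower_height k.
Proof.
exists (enum_rank (x n).1); first exact: enum_rankK.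
by rewrite /tower_height enum_rankK; exact: address_floor.
Qed.

Lemma tower_height_gt0 n (k : 'I_(tower_num n)) : 0 < tower_height k.
Proof. exact: height_gt0. Qed.

Lemma tower_partitionP n :
  partition [set i : 'I_(tower_num n) * nat | i.2 < tower_height i.1]
    (fun i => tower_set i.1 i.2) [set: X].
Proof.
split.
- apply/seteqP; split=> // x _; have [k kx kj] := tower_setP n x.
  by exists (k, (x n).2) => //=; rewrite /tower_set /= kx -surjective_pairing.
- move=> [k j] [k' j'] /= _ _ [x [/= xk]]; rewrite /tower_set /= xk.
  by move=> [/enum_val_inj -> ->].
- move=> [k j] /= jk; have fa : floor (@height B n) (enum_val k, j) by [].
  by have [x xn] := address_onto R fa; exists x.
Qed.

Lemma tower_clopen n (k : 'I_(tower_num n)) j : j < tower_height k ->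
  clopen (tower_set k j).
Proof. by move=> _; exact: (@cylinder_clopen R B n (fun a => a = (enum_val k, j))). Qed.

Lemma tower_step n (k : 'I_(tower_num n)) j : j.+1 < tower_height k ->
  phi @` tower_set k j = tower_set k j.+1.
Proof.
move=> jk; apply/seteqP; split=> [_ [x /= xn <-]|y yn].
  by apply/eqP; rewrite -vershik_up // xn.
exists (psi y); last exact: vershik_invK.
by apply/eqP; rewrite (vershik_up ends) // vershik_invK yn.
Qed.

Lemma tower_topE n : \bigcup_(k : 'I_(tower_num n)) tower_set k (tower_height k).-1 =
  [set x | top (@height B n) (x n)].
Proof.
apply/seteqP; split=> [x [k _ /= ->]|x tx].
  by rewrite /top /= prednK // height_gt0.
have [k kx kj] := tower_setP n x; exists k => //.
rewrite /tower_set /= /tower_height kx [LHS]surjective_pairing; congr pair.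
by rewrite -(eqP tx).
Qed.

Lemma tower_bottomE n : \bigcup_(k : 'I_(tower_num n)) tower_set k 0 =
  [set x | bottom (x n)].
Proof.
apply/seteqP; split=> [x [k _ /= ->] //|x bx].
have [k kx kj] := tower_setP n x; exists k => //.
by rewrite /tower_set /= kx [LHS]surjective_pairing (eqP bx).
Qed.

Lemma tower_top_max n :
  (\bigcup_(k : 'I_(tower_num n)) tower_set k (tower_height k).-1) (max_point ends).
Proof. by rewrite tower_topE; exact: max_pointP. Qed.

Lemma tower_top_image n :
  phi @` (\bigcup_(k : 'I_(tower_num n)) tower_set k (tower_height k).-1) =
  \bigcup_(k : 'I_(tower_num n)) tower_set k 0.
Proof.
rewrite tower_topE tower_bottomE; apply/seteqP; split=> [_ [x /= tx <-]|y by_].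
  by rewrite vershik_bottom.
by exists (psi y); rewrite /= ?vershik_invK // -(vershik_bottom ends) vershik_invK.
Qed.

Definition tower_kr n : kr_partition phi (max_point ends) :=
  @KRPartition X phi (max_point ends) (tower_num n) (@tower_height n) (@tower_set n)
    (@tower_height_gt0 n) (tower_partitionP n) (@tower_clopen n) (@tower_step n)
    (tower_top_max n) (tower_top_image n).

Lemma tower_kr_topE n : kr_top (tower_kr n) = [set x | top (@height B n) (x n)].
Proof. exact: tower_topE. Qed.

Lemma tower_kr_partsP n (A : set X) : kr_parts (tower_kr n) A <->
  exists2 a, floor (@height B n) a & A = [set x : X | x n = a].
Proof.
split=> [[[k j] /= jk <-]|[[v j] fa ->]]; first by exists (enum_val k, j).
exists (enum_rank v, j); first by rewrite /kr_index /= /tower_height enum_rankK.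
by rewrite /= /tower_set enum_rankK.
Qed.

Lemma tower_kr_system : kr_system tower_kr.
Proof.
split.
- apply/seteqP; split=> [A /tower_kr_partsP[a fa ->]|_ ->] /=.
    apply/seteqP; split=> // x _ /=; exact/floor_root/fa/address_floor.
  apply/tower_kr_partsP; exists (origin B 0); first exact: origin_floor.
  apply/seteqP; split=> // x _ /=.
  exact: floor_root (address_floor _ _) (origin_floor _ _).
- move=> n A /tower_kr_partsP[a fa ->].
  exists [set x : X | x n = proj n a]; last first.
    by move=> x /= xa; rewrite (address_proj x (leqnSn n)) xa.
  by apply/tower_kr_partsP; exists (proj n a) => //; exact: proj_floor.
- by move=> n _ x; rewrite !tower_kr_topE; exact: top_le.
- apply/seteqP; split=> [x xt|x ->] /=; last first.
    by move=> n _; rewrite tower_kr_topE; exact: max_pointP.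
  apply: max_point_uniq => n; apply: (top_le (leqnSn n)).
  by have := xt n.+1 isT; rewrite tower_kr_topE.
- split=> [A [n _ /tower_kr_partsP[a _ ->]]|x A /limit_nbhsP[n nA]].
    by have [] := @cylinder_clopen R B n (fun b => b = a).
  exists [set y : X | y n = x n]; last by move=> y; exact: nA.
  split=> //; exists n => //; apply/tower_kr_partsP; exists (x n) => //.
  exact: address_floor.
Qed.

Lemma limit_metrizable : metrizable R X.
Proof.
exists X, id; split; first by move=> x; exact: cvg_id.
by exists id; split=> // x; exact: cvg_id.
Qed.

Lemma limit_totally_disconnected : totally_disconnected [set: X].
Proof. exact/zero_dimension_totally_disconnected/limit_zero_dimensional. Qed.

Lemma vershik_iter x n v j i : x n = (v, j) -> j + i < height v ->
  iter i phi x n = (v, j + i).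
Proof.
move=> xn; elim: i => [|i IH]; first by rewrite addn0.
rewrite addnS => ji; apply/eqP; rewrite iterS -vershik_up //.
by rewrite IH // ltnW.
Qed.

Lemma vershik_inv_iter x n v j i : x n = (v, j + i) -> iter i psi x n = (v, j).
Proof.
elim: i x => [|i IH] x; first by rewrite addn0.
rewrite addnS => xn; rewrite iterSr; apply: IH; apply/eqP.
rewrite (vershik_up ends) ?vershik_invK ?xn //.
by have := address_floor x n; rewrite xn.
Qed.

Hypothesis simpleB : simple_obd B.

(** By simplicity the vertex of [a] occurs in every word of some level m, so every tower of level m
    meets the floor [a]. A point reaches it by moving up or down inside its own tower, in fewer
    steps than the largest height at level m. *)
Lemma vershik_visit n a : floor (@height B n) a -> exists M, forall y, exists2 i,
  i < M & iter i phi y n = a \/ iter i psi y n = a.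
Proof.
move=> fa; have [m nm mP] := simpleB n.
exists (\max_(w : V B m) height w) => y.
case Ey : (y m) => [w l]; have := address_floor y m; rewrite Ey /floor /= => lw.
have : a \in floors (@height B n) (sub n w).
  rewrite mem_floors fa andbT; apply/mem_word.
  by have [e [<- <-]] := mP a.1 w; exists e.
move=> /(nthP (origin B n))[j]; rewrite (height_compat_sub (ltnW nm)) => jw aE.
have max_height : height w <= \max_(w : V B m) height w by exact: leq_bigmax.
have aP x : x m = (w, j) -> x n = a.
  by move=> xm; rewrite (address_proj x (ltnW nm)) xm.
case: (leqP l j) => lj.
  exists (j - l); first exact: leq_ltn_trans (leq_subr _ _) (leq_trans jw _).
  left; apply: aP; rewrite (vershik_iter Ey) subnKC //.
exists (l - j); first exact: leq_ltn_trans (leq_subr _ _) (leq_trans lw _).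
by right; apply: aP; apply: vershik_inv_iter; rewrite Ey subnKC // ltnW.
Qed.

Lemma vershik_minimal : minimal_system phi.
Proof.
split; [by exists (max_point ends) | exact: closedT | |].
  by apply/seteqP; split=> // y _; exists (psi y) => //; exact: vershik_invK.
move=> Y [y0 Yy0] cY phiY _; apply/seteqP; split=> // x _; apply: cY.
have phiI y : Y y -> Y (phi y) by move=> Yy; rewrite -phiY; exists y.
have psiI y : Y y -> Y (psi y).
  by move=> Yy; have : Y y by []; rewrite -{1}phiY => -[z Yz <-]; rewrite vershikK.
have iterI f i : (forall y, Y y -> Y (f y)) -> Y (iter i f y0).
  by move=> fI; elim: i => //= i; exact: fI.
move=> A /limit_nbhsP[n nA].
have [M visit] := vershik_visit (address_floor x n).
have [i _ [iy|iy]] := visit y0.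
  by exists (iter i phi y0); split; [exact: iterI | exact: nA].
by exists (iter i psi y0); split; [exact: iterI | exact: nA].
Qed.

(** An isolated point would be a whole cylinder, met by every orbit within M steps, so the space
    would consist of finitely many iterates of that point. *)
Lemma limit_cantor : infinite_set (path_space B) -> cantor_set X.
Proof.
move=> /(infinite_path_space R B) infX.
have perf : perfect_set [set: X].
  apply/perfectTP => x ox; apply: infX.
  have /limit_nbhsP[n nx] : nbhs x [set x] by apply: open_nbhs_nbhs.
  have [M visit] := vershik_visit (address_floor x n).
  have fin f : finite_set ((fun i => iter i f x) @` `I_M).
    exact/finite_image/finite_II.
  apply: sub_finite_set (_ : finite_set (((fun i => iter i psi x) @` `I_M) `|`
    ((fun i => iter i phi x) @` `I_M))); last by rewrite finite_setU; split.
  move=> y _; have [i iM [/nx E|/nx E]] := visit y.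
    left; exists i => //; rewrite -E; elim: i {iM E} => // k IH.
    by rewrite iterSr iterS vershikK IH.
  right; exists i => //; rewrite -E; elim: i {iM E} => // k IH.
  by rewrite iterSr iterS vershik_invK IH.
have [f [cf clf]] := @homeomorphism_cantor_like R X (And4 perf (@limit_compact R B)
  (@limit_hausdorff R B) (@limit_zero_dimensional R B)).
have fK : cancel f (f^-1)%FUN by move=> x; rewrite funK // inE.
have gK : cancel (f^-1)%FUN f by move=> x; rewrite invK // inE.
exists (f^-1)%FUN; split; last by exists f.
apply: compact_inverse_continuous cf fK gK; last exact: limit_hausdorff.
exact: cantor_space_compact.
Qed.

Lemma vershik_minimal_unique : exists! Y : set X, minimal_subset phi Y.
Proof.
exists [set: X]; split=> [|Y [Y0 cY phiY _]]; first exact: vershik_minimal.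
by have [_ _ _ H] := vershik_minimal; rewrite (H Y).
Qed.

Lemma max_point_minimal (Y : set X) : minimal_subset phi Y -> Y (max_point ends).
Proof.
by move=> [Y0 cY phiY _]; have [_ _ _ H] := vershik_minimal; rewrite (H Y).
Qed.

Definition tower_system : sds R :=
  @SDSystem R X phi (max_point ends) tower_kr limit_metrizable
    (@limit_compact R B) limit_totally_disconnected (vershik_homeo ends)
    vershik_minimal_unique max_point_minimal tower_kr_system.

End TowerSystem.

(** * The map induced by a premorphism *)

Section PremorphismMap.
Variables (B C : obd) (f : premorphism B C).

Definition pword n (w : V C (lev f n)) : seq (V B n) := word (pedge f n) w.

Definition pfloor n : V C (lev f n) * nat -> V B n * nat :=
  subst_floor (@height B n) (origin B n) (@pword n).

Lemma pword_comm m n w : m <= n ->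
  flatten (map (@sub B m n) (pword w)) =
  flatten (map (@pword m) (sub (lev f m) w)).
Proof.
move=> mn; rewrite -!(word_comp (path_edges B m n)).
by rewrite (eiso_word (pedge_comm_le f mn)) word_comp.
Qed.

Lemma size_pword0 w : size (@pword 0 w) = 1.
Proof.
apply/eqP; rewrite eqn_leq /pword /word size_map; apply/andP; split.
  rewrite -(pedge0_singleton f) cardE; apply: uniq_leq_size; first exact: fibre_uniq.
  by move=> e _; rewrite mem_enum.
have [e ew] := @pedge_rng_surj _ _ f 0 w.
have : e \in fibre (pedge f 0) w by rewrite mem_fibre ew.
by case: (fibre _ _).
Qed.

(** The commutation relation is used down to level 0: expanding the letters of [pword w] into paths
    from the root gives the same list as replacing each path of C from the root to w by a word of
    length 1. *)
Lemma pword_height n : height_compat (@height B n) (@height C (lev f n)) (@pword n).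
Proof.
move=> w; rewrite size_floors.
have -> : sumn (map (@height B n) (pword w)) =
    size (flatten (map (@sub B 0 n) (pword w))).
  by rewrite size_flatten /shape -map_comp.
rewrite pword_comm // size_flatten /shape -map_comp.
rewrite (eq_map (g := fun=> 1)); last by move=> v; rewrite /= size_pword0.
rewrite (_ : sumn _ = size (sub (lev f 0) w)); last first.
  by elim: (sub _ w) => //= v s ->.
(* [lev f 0] occurs in types, so it is generalised before being replaced by 0. *)
suff H k : k = 0 -> size (sub k w) = height w by apply: H; exact: lev0.
by move=> ->.
Qed.

Lemma pfloor_floor n a : floor (@height C (lev f n)) a ->
  floor (@height B n) (pfloor a).
Proof. exact/subst_floorP/pword_height. Qed.

Lemma pfloor_proj m n a : m <= n -> floor (@height C (lev f n)) a ->
  proj m (@pfloor n a) = pfloor (proj (lev f m) a).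
Proof.
move=> mn fa; rewrite /proj /pfloor.
rewrite -(subst_floor_comp _ _ (height_compat_sub mn) (@pword_height n) fa).
rewrite -(subst_floor_comp _ _ (@pword_height m) (height_compat_sub (lev_le f mn)) fa).
by rewrite /subst_floor pword_comm.
Qed.

Variable R : realType.
Implicit Types x : tower_limit R C.

Lemma premorphism_coherent x :
  coherent (fun n => pfloor (x (lev f n))).
Proof.
split=> [n|m n mn]; first exact/pfloor_floor/address_floor.
rewrite pfloor_proj //; last exact: address_floor.
by rewrite -(address_proj x) // lev_le.
Qed.

Definition premorphism_map x : tower_limit R B := TowerLimit R (premorphism_coherent x).

Lemma premorphism_map_continuous : continuous premorphism_map.
Proof.
apply: limit_continuous => n x; apply/limit_nbhsP; exists (lev f n) => y /= -> //.
Qed.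

Lemma premorphism_map_step x y : stepx x y ->
  stepx (premorphism_map x) (premorphism_map y).
Proof.
move=> xy n; apply: subst_floor_step.
- exact: height_gt0.
- exact: pword_height.
- exact: address_floor.
- exact: address_floor.
- exact: xy.
Qed.

Lemma premorphism_map_top x : (forall n, top (@height C n) (x n)) ->
  forall n, top (@height B n) (premorphism_map x n).
Proof.
by move=> xt n; apply: subst_floor_top; [exact: height_gt0 | exact: pword_height |].
Qed.

End PremorphismMap.

Arguments premorphism_map {B C} f {R} x.

Lemma pfloor_agree (B C : obd) (f g : premorphism B C) n k a :
  lev f n <= k -> lev g n <= k ->
  pedge f n ∘ path_edges C (lev f n) k ≅ pedge g n ∘ path_edges C (lev g n) k ->
  floor (@height C k) a ->
  @pfloor _ _ f n (proj (lev f n) a) = @pfloor _ _ g n (proj (lev g n) a).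
Proof.
move=> fk gk fg fa.
rewrite /pfloor /proj.
rewrite -(subst_floor_comp _ _ (@pword_height _ _ f n) (height_compat_sub fk) fa).
rewrite -(subst_floor_comp _ _ (@pword_height _ _ g n) (height_compat_sub gk) fa).
rewrite /subst_floor -!(word_comp (pedge _ n)); congr nth; congr floors.
exact: eiso_word.
Qed.

Section MapEquiv.
Variables (R : realType) (B C : obd) (f g : premorphism B C).

(** Both directions go through [pm_agree]. If the maps agree, then since every floor of a tower of a
    common level k contains a point, f and g place it on the same floor of B; the floor lists agree
    and [floorsK] recovers the words. *)
Lemma premorphism_map_equivP :
  pm_equiv f g <-> @premorphism_map _ _ f R =1 @premorphism_map _ _ g R.
Proof.
rewrite pm_equivP; split=> [fg x|fg n].
  apply: limit_ext => n /=; have [k [fk gk H]] := fg n.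
  rewrite (address_proj x fk) (address_proj x gk).
  exact: pfloor_agree (address_floor x k).
pose k := maxn (lev f n) (lev g n).
have fk : lev f n <= k by exact: leq_maxl.
have gk : lev g n <= k by exact: leq_maxr.
exists k; split=> //; apply: word_eiso => w; rewrite !word_comp.
apply: (can_inj (floorsK (@height_gt0 B n))).
rewrite (floors_subst (origin B n) (@pword_height _ _ f n)).
rewrite (floors_subst (origin B n) (@pword_height _ _ g n)).
have E (h : premorphism B C) : lev h n <= k ->
    floors (@height C (lev h n)) (word (path_edges C (lev h n) k) w) =
    map (@proj C (lev h n) k) (floors (@height C k) [:: w]).
  by move=> hk; rewrite -(floors_subst (origin C _) (height_compat_sub hk)) /= cats0.
rewrite E // E // -!map_comp; apply/eq_in_map => a.
rewrite mem_floors => /andP[_ fa] /=; have [x xa] := address_onto R fa.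
rewrite -xa -!address_proj //; have := congr1 (fun y : tower_limit R B => y n) (fg x).
by [].
Qed.

End MapEquiv.

Lemma premorphism_map_id (R : realType) (B : obd) (x : tower_limit R B) :
  premorphism_map (pm_id B) x = x.
Proof.
apply: limit_ext => n; apply: subst_floor_id; last exact: address_floor.
by rewrite /pword /= path_edges_diag word_diag.
Qed.

Lemma premorphism_map_comp (R : realType) (B C D : obd) (f : premorphism B C)
    (g : premorphism C D) (x : tower_limit R D) :
  premorphism_map (pm_comp f g) x = premorphism_map f (premorphism_map g x).
Proof.
apply: limit_ext => n /=; have fx := address_floor x (lev g (lev f n)).
rewrite /pfloor.
rewrite -(subst_floor_comp _ _ (@pword_height _ _ f n) (@pword_height _ _ g _) fx).
by rewrite /subst_floor /pword /= word_comp.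
Qed.

(** * Fullness *)

Section PremorphismOfWords.
Variables (R : realType) (B C : obd).
Local Notation X := (tower_limit R C).
Local Notation Y := (tower_limit R B).
Variables (alpha : X -> Y) (l : nat -> nat) (t : forall n, V C (l n) -> seq (V B n)).
Arguments t : clear implicits.
Hypotheses (l0 : l 0 = 0) (l_mono : forall n, l n <= l n.+1).
Hypothesis l_unbounded : forall N, exists n, N <= l n.
Hypothesis tP : forall n, height_compat (@height B n) (@height C (l n)) (t n).
Hypothesis alphaE : forall x n,
  alpha x n = subst_floor (@height B n) (origin B n) (t n) (x (l n)).
Hypothesis alpha_onto : forall y, exists x, alpha x = y.

Let F n : edge_set (V B n) (V C (l n)) := of_words (t n).

Let F_word n w : word (F n) w = t n w.
Proof. exact: word_of_words. Qed.

(** Surjectivity of [alpha] enters here: the tower v contains some [alpha x], so the tower of x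
    crosses v. *)
Let F_src_surj n : src_surj (F n).
Proof.
apply: of_words_src_surj => v; have fv : floor (@height B n) (v, 0) by exact: height_gt0.
have [y yv] := address_onto R fv; have [x xy] := alpha_onto y.
have := subst_floor_mem (origin B n) (@tP n) (address_floor x (l n)).
rewrite -alphaE xy yv mem_floors => /andP[vx _].
by exists (x (l n)).1.
Qed.

Let F_rng_surj n : rng_surj (F n).
Proof.
apply: of_words_rng_surj => w.
by rewrite (height_compat_neq_nil (@tP n)) ?height_gt0.
Qed.

Let F_nonempty n : 0 < #|F n|.
Proof. exact: src_surj_nonempty (V_nonempty B n) (@F_src_surj n). Qed.

(** At level 0 both heights are 1, so the only word has a single letter. *)
Let F0_singleton : #|F 0| = 1.
Proof.
apply/eqP; rewrite eqn_leq F_nonempty andbT; apply/card_le1_eqP => e e' _ _.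
have /fintype_le1P V1 : #|V C (l 0)| <= 1 by rewrite l0 V0_singleton.
have r0 (p : F 0) : rank p = 0.
  have := rank_lt p; rewrite F_word; have := @tP 0 (rng (F 0) p).
  rewrite size_floors (eq_map (@height0 B)).
  have -> : height (rng (F 0) p) = 1.
    by move: (rng (F 0) p); rewrite l0; exact: height0.
  case: (t 0 _) => //= v s; case: s => //= _; rewrite ltnS leqn0 => /eqP //.
by apply: rank_inj; [exact: V1 | rewrite !r0].
Qed.

(** Each floor of the tower w contains a point x, and the corresponding entry of either floor list
    is [alpha x n]. *)
Let F_comm n : E B n ∘ F n.+1 ≅ F n ∘ path_edges C (l n) (l n.+1).
Proof.
apply: word_eiso => w; rewrite !word_comp F_word (eq_map (F_word (n := n))).
rewrite -(eq_map (@sub_edge B n)); apply: (can_inj (floorsK (@height_gt0 B n))).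
rewrite (floors_subst (origin B n) (height_compat_sub (leqnSn n))).
rewrite (floors_subst (origin B n) (@tP n)).
have -> : t n.+1 w = flatten (map (t n.+1) [:: w]) by rewrite /= cats0.
rewrite (floors_subst (origin B _) (@tP n.+1)).
have -> : word (path_edges C (l n) (l n.+1)) w =
    flatten (map (@sub C (l n) (l n.+1)) [:: w]) by rewrite /= cats0.
rewrite (floors_subst (origin C _) (height_compat_sub (l_mono n))) -!map_comp.
apply/eq_in_map => a; rewrite mem_floors => /andP[_ fa] /=.
have [x xa] := address_onto R fa; rewrite -xa -alphaE -/(proj n _).
by rewrite -address_proj // -/(proj _ _) -(address_proj x (l_mono n)) alphaE.
Qed.

Lemma premorphism_of_words :
  exists f : premorphism B C, premorphism_map f =1 alpha.
Proof.
exists (@Premorphism B C l F l0 l_mono l_unbounded F_nonempty F_src_surj F_rng_surj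
  F0_singleton F_comm) => x; apply: limit_ext => n.
by rewrite alphaE /= /pfloor /subst_floor /pword F_word.
Qed.

End PremorphismOfWords.

Section MapFull.
Variables (R : realType) (B C : obd).
Hypotheses (endsB : unique_ends R B) (endsC : unique_ends R C).
Local Notation X := (tower_limit R C).
Local Notation Y := (tower_limit R B).
Variable alpha : X -> Y.
Hypothesis alpha_cont : continuous alpha.
Hypothesis alpha_vershik : forall x, alpha (vershik endsC x) = vershik endsB (alpha x).
Hypothesis alpha_max : alpha (max_point endsC) = max_point endsB.
Hypothesis alpha_onto : forall y, exists x, alpha x = y.

(** What [tower_words] requires of the coarse address [alpha x n] relative to the fine address
    [x k]. *)
Let fine n k : Prop :=
  [/\ forall x y : X, x k = y k -> alpha x n = alpha y n,
      forall x : X, top (@height C k) (x k) -> top (@height B n) (alpha x n) &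
      forall x : X, bottom (x k) -> bottom (alpha x n)].

Let alpha_near n (x : X) : exists k, forall y : X, y k = x k -> alpha y n = alpha x n.
Proof.
suff /alpha_cont/limit_nbhsP[k kP] : nbhs (alpha x) [set z : Y | z n = alpha x n].
  by exists k.
by apply/limit_nbhsP; exists n.
Qed.

(** Pairs violating this at every level k would accumulate at a point, where [alpha_near] fails. *)
Let alpha_uniform n : exists k, forall x y : X, x k = y k -> alpha x n = alpha y n.
Proof.
apply: contrapT => /forallNP H.
pose P k a := exists x y : X, [/\ x k = a, y k = a & alpha x n <> alpha y n].
have [z zP] : exists z : X, forall k, P k (z k).
  apply: limit_koenig => [k|z j k jk [x [y [xk yk xy]]]].
    have /existsNP[x /existsNP[y /not_implyP[xy axy]]] := H k.
    by exists x, x, y.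
  by exists x, y; split=> //; [exact: address_le xk | exact: address_le yk].
have [k kP] := alpha_near n z; have [x [y [xk yk]]] := zP k; apply.
by rewrite (kP x xk) (kP y yk).
Qed.

Let fine_le n k k' : k <= k' -> fine n k -> fine n k'.
Proof.
move=> kk [f1 f2 f3]; split=> [x y xy|x xt|x xb].
- exact/f1/(address_le kk).
- exact/f2/(top_le kk).
- exact/f3/(bottom_le kk).
Qed.

(** Tops of a high level are close to the maximal point, which [alpha] preserves; bottoms are the
    images of tops under the Vershik map, with which [alpha] commutes. *)
Let fine_ex n : exists k, fine n k.
Proof.
have [k1 k1P] := alpha_uniform n.
have [j jP] := alpha_near n (max_point endsC).
have [k2 k2P] := end_close j (E := fun m => top (@height C m)) (@top_le R C)
  (max_point_uniq endsC).
have tops (x : X) : top (@height C (maxn k1 k2)) (x (maxn k1 k2)) ->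
    top (@height B n) (alpha x n).
  move=> /(top_le (leq_maxr k1 k2))/k2P/jP ->; rewrite alpha_max; exact: max_pointP.
exists (maxn k1 k2); split=> [x y xy|//|x xb].
  exact/k1P/(address_le (leq_maxl k1 k2)).
rewrite -(vershik_invK endsC x) alpha_vershik vershik_bottom; apply: tops.
by rewrite -(vershik_bottom endsC) vershik_invK.
Qed.

Let fine0 : fine 0 0.
Proof.
split=> [x y _|x _|x _].
- exact: floor_root (address_floor _ _) (address_floor _ _).
- by have := address_floor (alpha x) 0; rewrite /floor /top height0 ltnS leqn0 => /eqP ->.
- by have := address_floor (alpha x) 0; rewrite /floor /bottom height0 ltnS leqn0.
Qed.

Lemma premorphism_map_full :
  exists f : premorphism B C, premorphism_map f =1 alpha.
Proof.
have [K KP] := choice fine_ex.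
(* The term [l n'] gives monotonicity, [n] unboundedness and [K n] fineness; premorphisms force the
   value 0 at 0, which [fine0] permits. *)
pose l := fix l n := if n is n'.+1 then maxn (l n') (maxn n (K n)) else 0.
have lP n : fine n (l n).
  case: n => [|n]; first exact: fine0.
  by apply: fine_le (KP n.+1); rewrite /= !leq_max leqnn !orbT.
have t_ex n : exists t : V C (l n) -> seq (V B n),
    height_compat (@height B n) (@height C (l n)) t /\
    forall x : X, alpha x n = subst_floor (@height B n) (origin B n) t (x (l n)).
  have [f1 f2 f3] := lP n.
  have [t [tP tE]] := @tower_words X (vershik endsC) (V B n) (V C (l n))
    (@height B n) (@height C (l n)) (origin B n) (fun x => alpha x n)
    (fun x => x (l n)) (@height_gt0 C (l n)) (fun x => address_floor (alpha x) n)
    (fun x => etrans (congr1 (fun z : Y => step (@height B n) (alpha x n) (z n))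
      (alpha_vershik x)) (vershikP endsB (alpha x) n))
    (fun x => vershikP endsC x (l n)) (@address_onto R C (l n)) f1 f2 f3.
  by exists t; split=> // x; apply: tE; exact: address_floor.
pose t n := projT1 (cid (t_ex n)).
have tP n := projT2 (cid (t_ex n)).
apply: (@premorphism_of_words R B C alpha l t) => //.
- by move=> n; rewrite /= leq_max leqnn.
- by case=> [|N]; [exists 0 | exists N.+1; rewrite /= !leq_max ltnSn orbT].
- by move=> n; have [] := tP n.
- by move=> x n; have [_] := tP n; exact.
Qed.

End MapFull.

(** * Minimality implies simplicity *)

Section MinimalSimple.
Variables (R : realType) (B : obd).
Hypothesis ends : unique_ends R B.
Local Notation X := (tower_limit R B).
Local Notation phi := (vershik ends).
Local Notation psi := (vershik_inv ends).
Local Notation xmax := (max_point ends).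
Hypothesis minB : minimal_system phi.

Let iter_continuous (f : X -> X) i : continuous f -> continuous (iter i f).
Proof.
move=> cf; elim: i => [|i IH] x; first exact: cvg_id.
by rewrite (_ : iter i.+1 f = f \o iter i f) //; apply: continuous_comp; [exact: IH | exact: cf].
Qed.

Let iterK i : cancel (iter i psi) (iter i phi).
Proof. by elim: i => // i IH x; rewrite iterSr iterS vershik_invK IH. Qed.

(* Otherwise the points whose whole orbit avoids the tower [v] form a closed
   invariant set, nonempty by compactness. *)
Lemma backward_visit n (v : V B n) : exists i, (iter i psi xmax n).1 = v.
Proof.
apply: contrapT => /forallNP H.
pose C N := [set x : X | forall i, (iter i psi (iter N phi x) n).1 <> v].
have Ccl N : closed (C N).
  have -> : C N = \bigcap_i ((iter i psi \o iter N phi) @^-1` [set x : X | (x n).1 <> v]).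
    by apply/seteqP; split=> [x xC i _|x xC i]; [exact: xC | exact: (xC i)].
  apply: closed_bigI => i _; apply: preimage_closed.
    move=> x _; apply: continuous_comp; apply: iter_continuous.
      exact: vershik_continuous.
    exact: vershik_inv_continuous.
  by have [] := @cylinder_clopen R B n (fun a => a.1 <> v).
have [z zC] : exists z, forall N, C N z.
  apply: compact_nested => [|N|N|N x xC i].
  - exact: limit_compact.
  - exact: Ccl.
  (* N steps forward from this point lead to [xmax], whose backward orbit avoids v by assumption. *)
  - by exists (iter N psi xmax) => i; rewrite iterK; exact: H.
  - by have := xC i.+1; rewrite iterSr iterS vershikK.
pose I := [set x : X | forall N, C N x].
have II : I = [set: X].
  have [_ _ _ minI] := minB; apply: minI => //; first by exists z.
    rewrite (_ : I = \bigcap_N C N); last first.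
      by apply/seteqP; split=> [x xI N _|x xI N]; [exact: xI | exact: (xI N)].
    by apply: closed_bigI => N _; exact: Ccl.
  apply/seteqP; split=> [_ [x xI <-] N i|y yI].
    by have := xI N.+1 i; rewrite iterSr.
  exists (psi y); last exact: vershik_invK.
  case=> [|N] i; first by have := yI 0 i.+1; rewrite iterSr.
  by rewrite iterSr vershik_invK; exact: yI.
have fv : floor (@height B n) (v, 0) by exact: height_gt0.
have [x xv] := address_onto R fv.
have : I x by rewrite II.
by move=> /(_ 0 0); rewrite /= xv.
Qed.

Let near_max n i : exists k, forall x : X, x k = xmax k ->
  forall j, j <= i -> iter j psi x n = iter j psi xmax n.
Proof.
have nr j : exists k, forall x : X, x k = xmax k -> iter j psi x n = iter j psi xmax n.
  have /(_ xmax) := @iter_continuous psi j (vershik_inv_continuous (ends := ends)).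
  move=> /(_ [set z : X | z n = iter j psi xmax n]) H.
  have /H/limit_nbhsP[k kP] : nbhs (iter j psi xmax) [set z : X | z n = iter j psi xmax n].
    by apply/limit_nbhsP; exists n.
  by exists k.
elim: i => [|i [k kP]].
  have [k kP] := nr 0; exists k => x xk j; rewrite leqn0 => /eqP ->; exact: kP.
have [l lP] := nr i.+1; exists (maxn k l) => x xkl j.
rewrite leq_eqVlt => /predU1P[->|ji].
  exact/lP/(address_le (leq_maxr k l)).
by apply: kP => //; exact: address_le (leq_maxl k l) xkl.
Qed.

(* With [i] the first backward hitting time of the tower [v] by the maximal
   point, the top of every tower of a high level [m] hits [v] at the same time
   and not before; hence the tower has more than [i] floors and contains [v]. *)
Lemma minimal_visit n (v : V B n) : exists m0, forall m, m0 <= m -> n <= m ->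
  forall w : V B m, v \in sub n w.
Proof.
have ex : exists i, (iter i psi xmax n).1 == v.
  by have [i <-] := backward_visit v; exists i.
case: (ex_minnP ex) => i /eqP iv imin.
have [k kP] := near_max n i.
have [m0 m0P] := end_close k (E := fun m => top (@height B m)) (@top_le R B)
  (max_point_uniq ends).
exists m0 => m m0m nm w.
have close (x : X) : top (@height B m) (x m) -> forall j, j <= i ->
    iter j psi x n = iter j psi xmax n.
  by move=> /(top_le m0m)/m0P; exact: kP.
have tw : top (@height B m) (w, (height w).-1) by rewrite /top /= prednK // height_gt0.
have [x xw] := address_onto R (top_floor tw).
have xt : top (@height B m) (x m) by rewrite xw.
have ih : i < height w.
  (* If the height were at most i, going back by it would reach another top of level m, and from
     there v would be hit after [i - height w] steps, against the minimality of i. *)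
  rewrite ltnNge; apply/negP => hi; have h0 := height_gt0 w.
  have y0 : iter (height w).-1 psi x m = (w, 0) by apply: vershik_inv_iter.
  have yt : top (@height B m) (iter (height w) psi x m).
    by rewrite -(prednK h0) iterS -(vershik_bottom ends) vershik_invK y0.
  have := close _ yt _ (leq_subr (height w) i).
  rewrite -iterD subnK // (close _ xt) // => E.
  have := imin (i - height w); rewrite -E iv eqxx => /(_ isT).
  by rewrite leqNgt ltn_subrL h0 (leq_trans h0 hi).
have xi : iter i psi x m = (w, (height w).-1 - i).
  apply: vershik_inv_iter; rewrite xw subnK //.
  by rewrite -ltnS prednK // height_gt0.
have fl : floor (@height B m) (w, (height w).-1 - i) by rewrite -xi; exact: address_floor.
have := subst_floor_mem (origin B n) (height_compat_sub nm) fl.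
rewrite mem_floors => /andP[+ _]; rewrite -/(proj n _) -xi -address_proj //.
by rewrite (close _ xt) // iv xi.
Qed.

Lemma minimal_simple : simple_obd B.
Proof.
move=> n; have [m0 m0P] := choice (@minimal_visit n).
exists (maxn n.+1 (\max_(v : V B n) m0 v)); first exact: leq_maxl.
move=> v w; apply/mem_word; apply: m0P.
  by apply: leq_trans (leq_maxr _ _); exact: leq_bigmax.
by apply: ltnW; exact: leq_maxl.
Qed.

End MinimalSimple.

(** * The diagram of a system of Kakutani-Rokhlin partitions *)

Section KRAddress.
Variables (X : topologicalType) (phi : X -> X) (x0 : X) (P : kr_partition phi x0).
Local Notation height := (@kr_height _ _ _ P).

Lemma kr_address_ex x : exists a : 'I_(kr_num P) * nat,
  floor height a /\ kr_set a.1 a.2 x.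
Proof.
have [cov _ _] := kr_partitionP P.
by have : [set: X] x by []; rewrite -cov => -[a ah xa]; exists a.
Qed.

Definition kr_address x := projT1 (cid (kr_address_ex x)).

Lemma kr_address_floor x : floor height (kr_address x).
Proof. by rewrite /kr_address; case: cid => a /= []. Qed.

Lemma kr_address_set x : kr_set (kr_address x).1 (kr_address x).2 x.
Proof. by rewrite /kr_address; case: cid => a /= []. Qed.

Lemma kr_addressE x k j : j < kr_height k -> kr_set k j x -> kr_address x = (k, j).
Proof.
move=> jk xkj; have [_ triv _] := kr_partitionP P.
apply: triv => //; first exact: kr_address_floor.
by exists x; split=> //; exact: kr_address_set.
Qed.

Lemma kr_address_onto a : floor height a -> exists x, kr_address x = a.
Proof.
case: a => k j fa; have [_ _ ne] := kr_partitionP P.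
by have [x xa] := ne (k, j) fa; exists x; exact: kr_addressE.
Qed.

Lemma kr_topP x : kr_top P x <-> top height (kr_address x).
Proof.
split=> [[k _ xk]|tx].
  by rewrite (kr_addressE _ xk) ?/top /= ?prednK // kr_height_gt0.
exists (kr_address x).1 => //; rewrite -(eqP tx).
exact: kr_address_set.
Qed.

Lemma kr_bottomP x : (\bigcup_(k : 'I_(kr_num P)) kr_set k 0) x <->
  bottom (kr_address x).
Proof.
split=> [[k _ xk]|bx]; first by rewrite (kr_addressE _ xk) // kr_height_gt0.
by exists (kr_address x).1 => //; have := kr_address_set x; rewrite (eqP bx).
Qed.

Lemma kr_address_step x : step height (kr_address x) (kr_address (phi x)).
Proof.
case: (boolP (top height (kr_address x))) => [tx|tx].
  rewrite step_top //; apply/kr_bottomP; rewrite -kr_top_image.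
  by exists x => //; apply/kr_topP.
rewrite stepN ?kr_address_floor //; apply/eqP.
have lt : (kr_address x).2.+1 < kr_height (kr_address x).1.
  by rewrite floor_topN ?kr_address_floor.
apply: kr_addressE => //; rewrite -kr_step //.
by exists x => //; exact: kr_address_set.
Qed.

Lemma kr_parts_address (A : set X) x : kr_parts P A -> A x ->
  A = kr_set (kr_address x).1 (kr_address x).2.
Proof. by move=> [[k j] jk <-] /= xA; rewrite (kr_addressE jk xA). Qed.

Lemma kr_part_address x : kr_parts P (kr_set (kr_address x).1 (kr_address x).2).
Proof. by exists (kr_address x) => //; exact: kr_address_floor. Qed.

End KRAddress.

Section SystemDiagram.
Variables (R : realType) (X : sds R).
Local Notation phi := (@dyn R X).
Local Notation x0 := (base X).
Local Notation address n := (@kr_address X phi x0 (kr X n)).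
Local Notation H n := (@kr_height X phi x0 (kr X n)).
Local Notation W n := 'I_(kr_num (kr X n)).

Let dyn_onto y : exists x, phi x = y.
Proof. by have [_ [g [_ _ gK]]] := dyn_homeo X; exists (g y). Qed.

Let part0 : kr_parts (kr X 0) = [set [set: X]].
Proof. by have [] := kr_systemP X. Qed.

Let address0 x y : address 0 x = address 0 y.
Proof.
have : kr_parts (kr X 0) (kr_set (address 0 x).1 (address 0 x).2).
  exact: kr_part_address.
rewrite {1}part0 /= => E; symmetry.
rewrite [RHS]surjective_pairing; apply: kr_addressE; first exact: kr_address_floor.
by rewrite E.
Qed.

Let top0 x : top (H 0) (address 0 x).
Proof.
rewrite (address0 x x0); apply/kr_topP; exact: kr_top_x0.
Qed.

Let refine n x y : address n.+1 x = address n.+1 y -> address n x = address n y.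
Proof.
move=> xy; have [_ /(_ n) ref _ _ _] := kr_systemP X.
have [A [[k j] jk AE] sub] := ref _ (kr_part_address (kr X n.+1) x).
have Ax : kr_set k j x by rewrite AE; exact/sub/kr_address_set.
have Ay : kr_set k j y by rewrite AE; apply: sub; rewrite xy; exact: kr_address_set.
by rewrite (kr_addressE jk Ax) (kr_addressE jk Ay).
Qed.

(** Tops are only required to decrease from level 1 on; at level 0 the single part X is a top. *)
Let refine_top n x : top (H n.+1) (address n.+1 x) -> top (H n) (address n x).
Proof.
case: n => [_|n]; first exact: top0.
have [_ _ dec _ _] := kr_systemP X.
by move=> /kr_topP/(dec n.+1 isT)/kr_topP.
Qed.

(** Points on bottom floors are the images of points on top floors. *)
Let refine_bottom n x : bottom (address n.+1 x) -> bottom (address n x).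
Proof.
have [y <-] := dyn_onto x.
rewrite (step_bottom (kr_address_floor _ _) (kr_address_step (kr X n.+1) y)).
rewrite (step_bottom (kr_address_floor _ _) (kr_address_step (kr X n) y)).
exact: refine_top.
Qed.

Let words_ex n := @tower_words X phi (W n) (W n.+1) (H n) (H n.+1) (address n x0)
  (address n) (address n.+1) (@kr_height_gt0 _ _ _ (kr X n.+1))
  (@kr_address_floor _ _ _ (kr X n)) (@kr_address_step _ _ _ (kr X n))
  (@kr_address_step _ _ _ (kr X n.+1)) (@kr_address_onto _ _ _ (kr X n.+1))
  (@refine n) (@refine_top n) (@refine_bottom n).

Definition kr_words n : W n.+1 -> seq (W n) := projT1 (cid (words_ex n)).

Lemma kr_words_compat n : height_compat (H n) (H n.+1) (@kr_words n).
Proof. by rewrite /kr_words; case: cid => t /= []. Qed.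

(** The default is arbitrary because addresses are always in range; [origin] can thus replace the
    default used to build [kr_words]. *)
Lemma kr_wordsE n x d :
  address n x = subst_floor (H n) d (@kr_words n) (address n.+1 x).
Proof.
have /(_ x) : forall x, floor (H n.+1) (address n.+1 x) ->
    address n x = subst_floor (H n) (address n x0) (@kr_words n) (address n.+1 x).
  by rewrite /kr_words; case: cid => t /= [].
move=> -> //; last exact: kr_address_floor.
by apply: set_nth_default; rewrite kr_words_compat; exact: kr_address_floor.
Qed.

Let kr_nonempty n : 0 < #|W n|.
Proof. by apply/card_gt0P; exists (address n x0).1. Qed.

Let kr0_singleton : #|W 0| = 1.
Proof.
apply/eqP; rewrite eqn_leq kr_nonempty andbT; apply/card_le1_eqP => k k' _ _.
have [x kx] := kr_address_onto (kr_height_gt0 k : floor (H 0) (k, 0)).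
have [y ky] := kr_address_onto (kr_height_gt0 k' : floor (H 0) (k', 0)).
by have := address0 x y; rewrite kx ky => -[].
Qed.

Let kr_src_surj n : src_surj (of_words (@kr_words n)).
Proof.
apply: of_words_src_surj => k.
have [x kx] := kr_address_onto (kr_height_gt0 k : floor (H n) (k, 0)).
exists (address n.+1 x).1.
have := subst_floor_mem (address n x0) (@kr_words_compat n)
  (kr_address_floor (kr X n.+1) x).
by rewrite -kr_wordsE kx mem_floors => /andP[].
Qed.

Let kr_rng_surj n : rng_surj (of_words (@kr_words n)).
Proof.
apply: of_words_rng_surj => k.
by rewrite (height_compat_neq_nil (@kr_words_compat n)) ?kr_height_gt0.
Qed.

Definition kr_obd : obd :=
  @OBDiagram (fun n => W n) (fun n => of_words (@kr_words n)) kr_nonempty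
    kr0_singleton
    (fun n => src_surj_nonempty (kr_nonempty n) (@kr_src_surj n))
    kr_src_surj kr_rng_surj.

(** At level 0 every point is on a top floor, so floor 0 is a top and the height is 1; above, both
    heights satisfy the same recursion. *)
Lemma kr_obd_height n : @height kr_obd n = H n.
Proof.
apply: funext => k; elim: n k => [|n IH] k.
  rewrite height0; apply/eqP; rewrite eqn_leq kr_height_gt0 /=.
  have [x kx] := kr_address_onto (kr_height_gt0 k : floor (H 0) (k, 0)).
  by have := top0 x; rewrite kx /top /= => /eqP <-.
rewrite -(height_compat_sub (leqnSn n)) -(@kr_words_compat n) !size_floors.
by rewrite sub_edge word_of_words; congr sumn; exact: eq_map.
Qed.

Lemma kr_coherent x : @coherent kr_obd (fun n => address n x).
Proof.
apply: coherent_succ => n; first by rewrite kr_obd_height; exact: kr_address_floor.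
rewrite (@kr_wordsE n x (origin kr_obd n)) /proj /subst_floor sub_edge.
by rewrite word_of_words kr_obd_height.
Qed.

Definition kr_point x : tower_limit R kr_obd := TowerLimit R (kr_coherent x).

Hypothesis cantorX : cantor_set X.

(** Distinct points are separated by a clopen set pulled back from the Cantor space, hence by a part
    of some partition, as the parts form a basis. *)
Lemma kr_point_inj : injective kr_point.
Proof.
move=> x y xy; apply: contrapT => /eqP ne.
have [f [fc [g [_ fK _]]]] := cantorX.
have fne : f x != f y by apply: contraNneq ne => /(can_inj fK) ->.
have [U [[oU _] Ux Uy]] := cantor_zero_dimensional fne.
have [_ _ _ _ [_ bas]] := kr_systemP X.
have nx : nbhs x (f @^-1` U) by apply: fc; exact: open_nbhs_nbhs.
have [A [[n _ An] Ax] AU] := bas x _ nx.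
apply: Uy; apply: AU; rewrite (kr_parts_address An Ax).
have -> : address n x = address n y.
  exact: (congr1 (fun z : tower_limit R kr_obd => z n) xy).
exact: kr_address_set.
Qed.

Lemma kr_point_continuous : continuous kr_point.
Proof.
apply: limit_continuous => n x; apply: filterS (_ : nbhs x
    (kr_set (address n x).1 (address n x).2)) => [y xy|] /=.
  by rewrite (kr_addressE (kr_address_floor _ x) xy) -surjective_pairing.
apply: open_nbhs_nbhs; split; last exact: kr_address_set.
by have [] := kr_clopen (kr_address_floor (kr X n) x).
Qed.

(** The image is closed by compactness, and dense because every floor of every partition is
    non-empty. *)
Lemma kr_point_onto b : exists x, kr_point x = b.
Proof.
have cl : closed (range kr_point).
  apply: compact_closed; first exact: limit_hausdorff.
  apply: continuous_compact; last exact: space_compact.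
  exact/continuous_subspaceT/kr_point_continuous.
suff [x _ xb] : range kr_point b by exists x.
apply: cl => A /limit_nbhsP[n nA].
have fb : floor (H n) (b n) by rewrite -kr_obd_height; exact: address_floor.
have [x xb] := kr_address_onto fb.
by exists (kr_point x); split; [exists x | exact: nA].
Qed.

Lemma kr_point_step x : stepx (kr_point x) (kr_point (phi x)).
Proof. by move=> n; rewrite kr_obd_height; exact: kr_address_step. Qed.

Lemma kr_point_top x : (forall n, top (@height kr_obd n) (kr_point x n)) <-> x = x0.
Proof.
split=> [xt|-> n]; last first.
  by rewrite kr_obd_height; apply/kr_topP; exact: kr_top_x0.
have [_ _ _ tops _] := kr_systemP X.
suff : [set x0] x by [].
rewrite -tops => n _; apply/kr_topP; rewrite -kr_obd_height; exact: xt.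
Qed.

(** The tops meet only in the base point, which gives the maximal point; predecessors of minimal
    points are maximal, so the only minimal one comes from [phi x0]. *)
Lemma kr_obd_ends : unique_ends R kr_obd.
Proof.
split.
  exists (kr_point x0); split; first exact/kr_point_top.
  by move=> b; have [x <-] := kr_point_onto b; move=> /kr_point_top ->.
exists (kr_point (phi x0)); split.
  move=> n; rewrite (step_bottom _ (kr_point_step x0 n)); last exact: address_floor.
  by move: n; apply/kr_point_top.
move=> b; have [x <-] := kr_point_onto b; have [y <-] := dyn_onto x => yb.
suff /kr_point_top -> : forall n, top (@height kr_obd n) (kr_point y n) by [].
move=> n; rewrite -(step_bottom _ (kr_point_step y n)) //; exact: address_floor.
Qed.

Lemma kr_point_vershik x : kr_point (phi x) = vershik kr_obd_ends (kr_point x).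
Proof. exact/esym/vershikE/kr_point_step. Qed.

Lemma kr_point_max : kr_point x0 = max_point kr_obd_ends.
Proof. exact/max_point_uniq/kr_point_top. Qed.

Lemma kr_vershik_minimal : minimal_system phi -> minimal_system (vershik kr_obd_ends).
Proof.
move=> [_ _ _ minX]; split; [by exists (kr_point x0) | exact: closedT | |].
  apply/seteqP; split=> // b _; exists (vershik_inv kr_obd_ends b) => //.
  exact: vershik_invK.
move=> Y [b Yb] cY phiY _; apply/seteqP; split=> // c _.
have [z <-] := kr_point_onto c.
suff E : kr_point @^-1` Y = [set: X] by have : [set: X] z by []; rewrite -E.
apply: minX => //.
- by have [x xb] := kr_point_onto b; exists x; rewrite /= xb.
- by apply: preimage_closed => // x _; exact: kr_point_continuous.
apply/seteqP; split=> [_ [x /= Yx <-]|y /= Yy].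
  by rewrite /= kr_point_vershik -phiY; exists (kr_point x).
have [x xy] := dyn_onto y; exists x => //=; move: Yy; rewrite -{1}phiY => -[d Yd].
by rewrite -xy kr_point_vershik => /(can_inj (vershikK kr_obd_ends)) <-.
Qed.

Lemma kr_point_inverse : exists g : tower_limit R kr_obd -> X,
  [/\ continuous g, cancel kr_point g & cancel g kr_point].
Proof.
have [g gP] := choice kr_point_onto.
have gK : cancel kr_point g by move=> x; exact/kr_point_inj/gP.
exists g; split=> //; apply: compact_inverse_continuous kr_point_continuous gK gP.
- exact: space_compact.
- exact: limit_hausdorff.
Qed.

End SystemDiagram.

(** * The equivalence *)

Lemma infinite_of_injection (T : Type) (h : nat -> T) :
  injective h -> infinite_set [set: T].
Proof.
move=> hI fin; apply: infinite_nat; rewrite (_ : [set: nat] = h @^-1` [set: T]) //.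
by apply: finite_preimage => // m n _ _; exact: hI.
Qed.

Section Functor.
Variable R : realType.

Let Dg : category := @full_subcategory OBDpo
  (fun B : OBDpo => simple_obd (sval B) /\ infinite_set (path_space (sval B))).
Let Sy : category := @full_subcategory (SDS R)
  (fun X : SDS R => cantor_set X /\ minimal_system (@dyn R X)).

Let dg (D : Dg) : obd := sval (sval D).

Lemma diagram_ends (D : Dg) : unique_ends R (dg D).
Proof. exact: (properly_orderedP R (dg D)).1 (svalP (sval D)). Qed.

Lemma diagram_simple (D : Dg) : simple_obd (dg D).
Proof. by have [] := svalP D. Qed.

Let Fspace (D : Dg) : sds R := tower_system (diagram_ends D) (@diagram_simple D).

Lemma Fspace_cantor_minimal (D : Dg) :
  cantor_set (Fspace D) /\ minimal_system (@dyn R (Fspace D)).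
Proof.
have [simpleD infD] := svalP D; split; last exact: vershik_minimal.
exact: (limit_cantor (diagram_ends D)).
Qed.

Let Fobj (D : Dg) : Sy := exist _ (Fspace D) (Fspace_cantor_minimal D).

Section Arrow.
Variables (D D' : Dg) (f : premorphism (dg D) (dg D')).

Lemma premorphism_map_vershik (x : tower_limit R (dg D')) :
  premorphism_map f (vershik (diagram_ends D') x) =
  vershik (diagram_ends D) (premorphism_map f x).
Proof. exact/esym/vershikE/premorphism_map_step/vershikP. Qed.

Lemma premorphism_map_max :
  premorphism_map f (max_point (diagram_ends D')) = max_point (diagram_ends D).
Proof. exact/max_point_uniq/premorphism_map_top/max_pointP. Qed.

Definition premorphism_hom : sds_hom (Fspace D') (Fspace D) :=
  @SDSHom R (Fspace D') (Fspace D) (@premorphism_map _ _ f R)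
    (@premorphism_map_continuous _ _ f R) premorphism_map_vershik premorphism_map_max.

End Arrow.

(** A representative is chosen; [Fmap_class] shows that the choice does not matter. *)
Let Fmap (D D' : Dg) (u : obd_hom (dg D) (dg D')) : sds_hom (Fspace D') (Fspace D) :=
  premorphism_hom (projT1 (cid (obd_hom_class u))).

Let Fmap_class D D' (f : premorphism (dg D) (dg D')) :
  Fmap (obd_class f) = premorphism_hom f.
Proof.
rewrite /Fmap; case: cid => g /= /obd_classP fg.
by apply: sds_hom_ext => x; rewrite /= (premorphism_map_equivP R f g).1.
Qed.

Let Fmap_id (D : Dg) : Fmap (obd_class (pm_id (dg D))) = sds_id (Fspace D).
Proof. by rewrite Fmap_class; apply: sds_hom_ext => x; exact: premorphism_map_id. Qed.

Let Fmap_comp (D D' D'' : Dg) (u : obd_hom (dg D) (dg D')) (v : obd_hom (dg D') (dg D'')) :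
  Fmap (obd_comp u v) = sds_comp (Fmap v) (Fmap u).
Proof.
have [f ->] := obd_hom_class u; have [g ->] := obd_hom_class v.
rewrite obd_comp_class !Fmap_class; apply: sds_hom_ext => x.
exact: premorphism_map_comp.
Qed.

Definition path_space_functor : contravariant_functor Dg Sy :=
  @ContravariantFunctor Dg Sy Fobj Fmap Fmap_id Fmap_comp.

Lemma path_space_functor_faithful : faithful path_space_functor.
Proof.
move=> D D' u v; have [f ->] := obd_hom_class u; have [g ->] := obd_hom_class v.
rewrite /= !Fmap_class => fg; apply/obd_classP/(premorphism_map_equivP R) => x.
exact: (congr1 (fun h : sds_hom (Fspace D') (Fspace D) => h x) fg).
Qed.

Lemma path_space_functor_full : full path_space_functor.
Proof.
move=> D D' u.
pose alpha : tower_limit R (dg D') -> tower_limit R (dg D) :=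
  @sds_map R (Fspace D') (Fspace D) u.
have ac : continuous alpha := @sds_map_continuous R (Fspace D') (Fspace D) u.
have av x : alpha (vershik (diagram_ends D') x) = vershik (diagram_ends D) (alpha x).
  exact: (@sds_map_dyn R (Fspace D') (Fspace D) u x).
have am : alpha (max_point (diagram_ends D')) = max_point (diagram_ends D).
  exact: (@sds_map_base R (Fspace D') (Fspace D) u).
have onto y : exists x, alpha x = y.
  suff E : range alpha = [set: tower_limit R (dg D)].
    by have : [set: tower_limit R (dg D)] y by []; rewrite -E => -[x _ <-]; exists x.
  have [_ [_ _ _ minD]] := Fspace_cantor_minimal D; apply: minD => //.
  - by exists (max_point (diagram_ends D)), (max_point (diagram_ends D')).
  - apply: compact_closed; first exact: limit_hausdorff.
    apply: continuous_compact; last exact: limit_compact.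
    exact: continuous_subspaceT.
  apply/seteqP; split=> [_ [_ [x _ <-] <-]|_ [x _ <-]].
    by exists (vershik (diagram_ends D') x).
  exists (alpha (vershik_inv (diagram_ends D') x)); first by eexists.
  by rewrite /= -av vershik_invK.
have [f fE] := premorphism_map_full ac av am onto.
exists (obd_class f); rewrite /= Fmap_class; apply: sds_hom_ext => x.
exact: fE.
Qed.

Lemma path_space_functor_essentially_surjective :
  essentially_surjective path_space_functor.
Proof.
move=> [X [cX mX]].
pose ends := kr_obd_ends X.
have po : properly_ordered (kr_obd X) := (properly_orderedP R (kr_obd X)).2 ends.
have sB : simple_obd (kr_obd X).
  exact/(minimal_simple (ends := ends))/kr_vershik_minimal.
have iB : infinite_set (path_space (kr_obd X)).
  apply/(infinite_path_space R); have [f [_ [h [_ fK hK]]]] := cX.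
  (* Indicator sequences of single integers supply infinitely many points. *)
  pose s n : cantor_space := fun k : nat => k == n.
  apply: (@infinite_of_injection _ (fun n => kr_point (h (s n)))) => m n.
  move=> /(kr_point_inj cX)/(can_inj hK)/(congr1 (fun z : cantor_space => z m)).
  by rewrite /s eqxx => /esym/eqP.
pose D : Dg := exist _ (exist _ (kr_obd X) po) (conj sB iB).
exists D.
(* The Vershik map depends on the proof of [unique_ends], and the functor uses the one recovered
   from [po]. *)
have endsE : diagram_ends D = ends by exact: Prop_irrelevance.
have [g [gc gK Kg]] := kr_point_inverse cX.
have kv x : kr_point (dyn x) = vershik (diagram_ends D) (kr_point x).
  by rewrite endsE; exact: kr_point_vershik.
have km : kr_point (base X) = max_point (diagram_ends D).
  by rewrite endsE; exact: kr_point_max.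
have gv y : g (vershik (diagram_ends D) y) = dyn (g y).
  by apply: (can_inj gK); rewrite Kg kv Kg.
have gm : g (max_point (diagram_ends D)) = base X by rewrite -km gK.
exists (@SDSHom R (Fspace D) X g gc gv gm).
exists (@SDSHom R X (Fspace D) (@kr_point R X) (@kr_point_continuous R X) kv km).
by split; apply: sds_hom_ext => x /=; [exact: Kg | exact: gK].
Qed.

End Functor.

Theorem corollary4p4 (R : realType) :
  contravariantly_equivalent
    (@full_subcategory OBDpo
       (fun B : OBDpo =>
          simple_obd (sval B) /\ infinite_set (path_space (sval B))))
    (@full_subcategory (SDS R)
       (fun X : SDS R => cantor_set X /\ minimal_system (@dyn R X))).
Proof.
exists (path_space_functor R); split.
- exact: path_space_functor_full.
- exact: path_space_functor_faithful.
- exact: path_space_functor_essentially_surjective.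
Qed.
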